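(* Let $n\ge 2$, let $S\subset\mathbb{R}^{n+1}$ be a smooth hypersurface, $y\in S$, and suppose that near $y$ the surface $S$ is the graph $\{(x,g(x))\}$ of a function $g$ of the first $n$ variables, with $(z,g(z))=y$. Put $H(x)=g(x+z)-g(z)-\nabla g(z)\cdot x$. Suppose $g$ is real-analytic and $N(H)$ is nonempty. Let $k$ denote the dimension of the face (compact or not) of $N(H)$ that intersects the critical line $\{(t,\dots,t):t\in\mathbb{R}\}$ in its interior, with $k=0$ if the line intersects $N(H)$ at a vertex. For $\lambda\in\mathbb{R}^{n+1}$ and a smooth cutoff function $\phi$ let $$T(\lambda)=\int_S e^{-i\lambda\cdot s}\phi(s)\,d\sigma(s).$$ (a) Suppose $d(H)\ge 2$ and each zero of each $H_F(x)$ ($F$ a compact face of $N(H)$) on $(\mathbb{R}-\{0\})^n$ has order at most $d(H)$. Then there is a neighborhood $U$ of $y$ such that if $\phi$ is supported in $U$ and is nonnegative with $\phi(y)\neq 0$, then $$\limsup_{r\to\infty}\ \sup_{|\lambda|=r}\frac{|T(\lambda)|}{|\lambda|^{-1/d(H)}(\ln|\lambda|)^{n-k-1}}>0 .$$ (b) Suppose the maximum order $m$ of any zero of any $H_F(x)$ on $(\mathbb{R}-\{0\})^n$ satisfies $m>\max(d(H),2)$. Suppose there is a sequence of points $a^l=(a^l_1,\dots,a^l_n)$ in $(\mathbb{R}-\{0\})^n$ with $a^l\to 0$ such that for each $l$ there is an index $i$ for which, on a neighborhood of $a^l$, the function $H$ is of the form $\xi_l(x)\bigl(x_i-b_l(x_1,\dots,x_{i-1},x_{i+1},\dots,x_n)\bigr)^m$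 for some real-analytic $b_l$ and $\xi_l$ with $\xi_l(a^l)\neq 0$ and $b_l(a^l_1,\dots,a^l_{i-1},a^l_{i+1},\dots,a^l_n)=a^l_i$. Then in any neighborhood $U$ of $y$ there is some $\phi$ supported in $U$ for which $$\limsup_{r\to\infty}\ \sup_{|\lambda|=r}\frac{|T(\lambda)|}{|\lambda|^{-1/m}}>0 .$$
   Context: $\sigma$ is the standard surface measure on $S$. The coordinates are assumed to be such that $(0,\dots,0,1)$ is not in the tangent space of $S$ at $y$ (so the graph representation exists); cutoff functions $\phi$ are smooth and compactly supported near $y$, within the region where $S$ is the graph of $g$. Newton polyhedron: let $f$ be smooth near the origin of $\mathbb{R}^n$ with Taylor expansion $\sum_\alpha f_\alpha x^\alpha$ at the origin. For each $\alpha$ with $f_\alpha\neq 0$ let $Q_\alpha=\{x\in\mathbb{R}^n: x_i\ge\alpha_i\text{ for all }i\}$. The Newton polyhedron $N(f)$ is the convex hull of the union of all these $Q_\alpha$. When $N(f)$ is nonempty, the Newton distance is $d(f)=\inf\{t:(t,\dots,t)\in N(f)\}$. For a compact face $F$ of $N(f)$ (a vertex is considered a compact face of dimension $0$), $f_F(x)=\sum_{\alpha\in F}f_\alpha x^\alpha$. The order of a zero of $f_F$ at a point is the smallest $|\alpha|$ such that $\partial^\alpha f_F$ is nonzero at that point. The number $k$ is thus the dimension of the face of $N(H)$ whose relative interior contains the point $(d(H),\dots,d(H))$ at which the critical line meets the boundary of $N(H)$. *)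

(* Defs.v *)
From HB Require Import structures.
From mathcomp Require Import all_boot all_order all_algebra.
From mathcomp Require Import all_classical all_reals all_analysis.
From mathcomp.real_closed Require Import complex.

Set Implicit Arguments.
Unset Strict Implicit.
Unset Printing Implicit Defensive.

Import Order.TTheory GRing.Theory Num.Theory.
Import numFieldNormedType.Exports.

Local Open Scope classical_set_scope.
Local Open Scope ring_scope.

Section Coordinates.
Context {R : realType}.

Definition dot n (u v : 'rV[R]_n) : R := \sum_i u 0 i * v 0 i.

(* The library norm on ['rV[R]_n] is the sup norm. *)
Definition enorm n (u : 'rV[R]_n) : R := Num.sqrt (dot u u).

Definition insert n (j : 'I_n.+1) (t : R) (x : 'rV[R]_n) : 'rV[R]_n.+1 :=
  \row_i (if unlift j i is Some k then x 0 k else t).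

Definition graph n (j : 'I_n.+1) (V : set 'rV[R]_n) (h : 'rV[R]_n -> R) :
  set 'rV[R]_n.+1 := [set insert j (h x) x | x in V].

End Coordinates.

Section Derivatives.
Context {R : realType}.

Definition pderiv n (i : 'I_n) (f : 'rV[R]_n -> R) : 'rV[R]_n -> R :=
  fun x => 'D_(delta_mx 0 i) f x.

Definition grad n (f : 'rV[R]_n -> R) (x : 'rV[R]_n) : 'rV[R]_n :=
  \row_i pderiv i f x.

(* To be used with [V] open. *)
Definition smooth_on n (V : set 'rV[R]_n) (f : 'rV[R]_n -> R) : Prop :=
  forall (s : seq 'I_n) (x : 'rV[R]_n), V x ->
    {for x, continuous (foldr (@pderiv n) f s)} /\
    forall i, derivable (foldr (@pderiv n) f s) x (delta_mx 0 i).

End Derivatives.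

Section MultiIndices.
Context {R : realType}.

Definition mindex n := {ffun 'I_n -> nat}.

Definition mdegree n (alpha : mindex n) : nat := (\sum_i alpha i)%N.

Definition monomial n (alpha : mindex n) (x : 'rV[R]_n) : R :=
  \prod_i x 0 i ^+ alpha i.

Definition mderiv n (alpha : mindex n) (f : 'rV[R]_n -> R) : 'rV[R]_n -> R :=
  foldr (fun i h => iter (alpha i) (pderiv i) h) f (enum 'I_n).

Definition taylor_coef n (f : 'rV[R]_n -> R) (alpha : mindex n) : R :=
  mderiv alpha f 0 / (\prod_i (alpha i)`!)%:R.

(* Near [a], [f] is the sum of an absolutely convergent power series; since
   the series is summable, its sum is the limit of its partial sums over the
   cubes {0, ..., N-1}^n. *)
Definition analytic_at n (f : 'rV[R]_n -> R) (a : 'rV[R]_n) : Prop :=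
  exists c : mindex n -> R, \forall x \near a,
    summable [set: mindex n]
      (fun alpha => (c alpha * monomial alpha (x - a))%:E) /\
    (fun N : nat => \sum_(beta : {ffun 'I_n -> 'I_N})
       let alpha : mindex n := [ffun i => nat_of_ord (beta i)] in
       c alpha * monomial alpha (x - a)) @ \oo --> f x.

Definition zero_of_order n (f : 'rV[R]_n -> R) (x : 'rV[R]_n) (m : nat) : Prop :=
  [/\ f x = 0,
      exists2 alpha, mdegree alpha = m & mderiv alpha f x != 0
    & forall alpha, (mdegree alpha < m)%N -> mderiv alpha f x = 0].

End MultiIndices.

Section ConvexGeometry.
Context {R : realType}.

Definition convex_hull n (A : set 'rV[R]_n) : set 'rV[R]_n :=
  smallest (@convex_set R 'rV[R]_n) A.

Definition affine_hull n (A : set 'rV[R]_n) : set 'rV[R]_n :=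
  [set x | exists (m : nat) (p : 'I_m -> 'rV[R]_n) (c : 'I_m -> R),
     [/\ forall i, A (p i), \sum_i c i = 1 & x = \sum_i c i *: p i]].

Definition relative_interior n (A : set 'rV[R]_n) : set 'rV[R]_n :=
  [set x | A x /\ \forall y \near x, affine_hull A y -> A y].

Definition affine_dim n (A : set 'rV[R]_n) (k : nat) : Prop :=
  exists (x0 : 'rV[R]_n) (L : {vspace 'rV[R]_n}),
    \dim L = k /\ affine_hull A = [set x0 + v | v in [set` L]].

(* Nonempty proper faces of a polyhedron, compact or not, as intersections with
   supporting hyperplanes. *)
Definition face_of n (N F : set 'rV[R]_n) : Prop :=
  exists (w : 'rV[R]_n) (c : R),
    [/\ w != 0, forall x, N x -> c <= dot w x,
        F = N `&` [set x | dot w x = c] & F !=set0].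

End ConvexGeometry.

Section NewtonPolyhedron.
Context {R : realType}.

Definition mpoint n (alpha : mindex n) : 'rV[R]_n := \row_i (alpha i)%:R.

Definition newton_polyhedron n (f : 'rV[R]_n -> R) : set 'rV[R]_n :=
  convex_hull (\bigcup_(alpha in [set alpha | taylor_coef f alpha != 0])
    [set x | forall i, (alpha i)%:R <= x 0 i]).

Definition newton_distance n (f : 'rV[R]_n -> R) : R :=
  inf [set t | newton_polyhedron f (const_mx t)].

(* Meant for compact [F], which contain finitely many lattice points. *)
Definition face_part n (f : 'rV[R]_n -> R) (F : set 'rV[R]_n) :
    'rV[R]_n -> R :=
  fun x => \sum_(alpha \in [set alpha : mindex n | F (mpoint alpha)])
    taylor_coef f alpha * monomial alpha x.

Definition face_zero_order n (f : 'rV[R]_n -> R) : set nat :=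
  [set m | exists (F : set 'rV[R]_n) (x : 'rV[R]_n),
    [/\ face_of (newton_polyhedron f) F, compact F, forall i, x 0 i != 0
      & zero_of_order (face_part f F) x m]].

Definition critical_face_dim n (f : 'rV[R]_n -> R) (k : nat) : Prop :=
  exists F, [/\ face_of (newton_polyhedron f) F,
    relative_interior F (const_mx (newton_distance f)) & affine_dim F k].

End NewtonPolyhedron.

Notation borel_rV R n := (g_sigma_algebraType (@open 'rV[R]_n)).

Section Surfaces.
Context {R : realType}.

(* Embedded hypersurfaces, as local graphs over coordinate hyperplanes. *)
Definition smooth_hypersurface n (S : set 'rV[R]_n.+1) : Prop :=
  forall p, S p -> exists (j : 'I_n.+1) (V : set 'rV[R]_n)
      (W : set 'rV[R]_n.+1) (h : 'rV[R]_n -> R),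
    [/\ open V, open W, W p, smooth_on V h & S `&` W = graph j V h].

(* Iterated integral; by Tonelli it is the integral with respect to
   n-dimensional Lebesgue measure when [f] is Borel and nonnegative. *)
Fixpoint lebesgue_rV n : ('rV[R]_n -> \bar R) -> \bar R :=
  match n with
  | 0 => fun f => f 0
  | m.+1 => fun f => lebesgue_rV (fun x : 'rV[R]_m =>
      (\int[lebesgue_measure]_t f (insert ord0 t x))%E)
  end.

(* These properties determine sigma uniquely: a hypersurface is
   covered by countably many graphs. *)
Definition surface_measure n (S : set 'rV[R]_n.+1)
    (sigma : {measure set (borel_rV R n.+1) -> \bar R}) : Prop :=
  sigma (~` S) = 0%E /\
  forall (j : 'I_n.+1) (V : set 'rV[R]_n) (h : 'rV[R]_n -> R),
    open V -> smooth_on V h -> graph j V h `<=` S ->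
    forall A : set (borel_rV R n.+1), measurable A ->
      sigma (A `&` graph j V h) =
      lebesgue_rV (fun x => (\1_V x * \1_A (insert j (h x) x) *
                             Num.sqrt (1 + dot (grad h x) (grad h x)))%:E).

Definition cutoff n (U : set 'rV[R]_n) (phi : 'rV[R]_n -> R) : Prop :=
  [/\ smooth_on setT phi, compact (closure [set x | phi x != 0])
    & closure [set x | phi x != 0] `<=` U].

End Surfaces.

Section FourierTransform.
Context {R : realType}.

Definition expi (t : R) : R[i] := (cos t +i* sin t)%C.

Definition cintegral d (X : measurableType d) (mu : {measure set X -> \bar R})
    (D : set X) (f : X -> R[i]) : R[i] :=
  ((\int[mu]_(x in D) complex.Re (f x)) +i* (\int[mu]_(x in D) complex.Im (f x)))%C.

Definition surface_fourier n (S : set 'rV[R]_n.+1)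
    (sigma : {measure set (borel_rV R n.+1) -> \bar R})
    (phi : 'rV[R]_n.+1 -> R) (lambda : 'rV[R]_n.+1) : R[i] :=
  cintegral sigma S
    (fun s : borel_rV R n.+1 => expi (- dot lambda s) * (phi s)%:C%C).

(* limsup as r -> +oo of the supremum of [q] over the Euclidean sphere of
   radius r. *)
Definition limsup_sphere n (q : 'rV[R]_n -> R) : \bar R :=
  limf_esup (fun r : R =>
    ereal_sup [set (q lambda)%:E | lambda in [set v | enorm v = r]])
    (pinfty_nbhs R).

End FourierTransform.

(* Main.v *)
(** If the upper limit vanished, then [T(j l1) = o(j^-gam (ln j)^p)] along the
    integer multiples of the normal covector [l1 = (- grad g z, 1)] at [y], on
    which the phase is [j H(x - z)] up to a constant.  Summing the cosines against
    the Fejer kernel [|sum_(j < N) e^(i j H)|^2], which is at least [c N^2] where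
    [|H| <= 1/N], bounds the weighted measure of this sublevel set by
    [o(N^-gam (ln N)^p)]; integrality of [j] makes this a finite sum, so that no
    Fubini argument is needed.  The contradiction comes from disjoint boxes inside
    the sublevel set.

    In (a), let [w0] be the covector supporting the face [F] through [(d, ..., d)].
    Every [w] near the ray of [w0] and orthogonal to the directions of [F] attains
    its minimum over the Newton polyhedron at [(d, ..., d)], whence
    [|H| <= C e^-s], [s = d sum_i w_i], on the box [x_i ~ e^(-w_i)].  This box has
    volume about [e^(-s/d)], and there are about [s^(n-k-1)] admissible [w] at unit
    distance from each other.  In (b) the boxes follow the graph of [b_l]. *)

Require Import Defs.
From HB Require Import structures.
From mathcomp Require Import all_boot all_order all_algebra.
From mathcomp Require Import all_classical all_reals all_analysis measurable_realfun.
From mathcomp.real_closed Require Import complex.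
From mathcomp Require Import ring lra zify.

Set Implicit Arguments.
Unset Strict Implicit.
Unset Printing Implicit Defensive.

Import Order.TTheory GRing.Theory Num.Theory.
Import numFieldNormedType.Exports.

Local Open Scope classical_set_scope.
Local Open Scope ring_scope.

(** * Sums over cubes of multi-indices and power series *)

Section CubeSums.
Context {R : realType} {n : nat}.
Implicit Types (t u : mindex n -> R).

(** The kernel is nonnegative everywhere, so the part of the surface outside the boxes may be
    discarded: only lower bounds of measures by open boxes are needed, never the size of a whole
    sublevel set. On the sublevel set every phase [j H] with [j < N] is at most 1 in absolute value,
    so all cosines are at least [cos 1].

    The exponent [gam], which is [1/d(H)] or [1/m], is at most 1/2. Hence the sum of [j^-gam] over
    [j < N] has order [N^(1-gam)], the same order as N times the measure of the boxes, and the
    finitely many initial terms, about which a little-o says nothing, are negligible. This is why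
    little-o decay is contradictory.

    Analyticity takes the place of a Taylor remainder: one bound on the sum of [|c_al| r^|al|]
    controls all monomials at once, so a factor [e^-s] gained on each monomial in a box is gained by
    H itself. In (a) each side of a box spans a ratio e, so two boxes whose weights differ by more
    than 1 in some coordinate are disjoint. *)

Definition cube_index N (b : {ffun 'I_n -> 'I_N}) : mindex n :=
  [ffun i => nat_of_ord (b i)].

Definition csum N t : R := \sum_(b : {ffun 'I_n -> 'I_N}) t (cube_index b).

Lemma cube_index_inj N : injective (@cube_index N).
Proof.
by move=> b b' /ffunP bb'; apply/ffunP => i; have := bb' i; rewrite !ffunE => /val_inj.
Qed.

Lemma le_csum N t u : (forall al, t al <= u al) -> csum N t <= csum N u.
Proof. by move=> tu; apply: ler_sum => b _. Qed.

Lemma eq_csum N t u : t =1 u -> csum N t = csum N u.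
Proof. by move=> tu; apply: eq_bigr => b _. Qed.

Lemma csumB N t u : csum N (fun al => t al - u al) = csum N t - csum N u.
Proof. by rewrite /csum sumrB. Qed.

Lemma csumD N t u : csum N (fun al => t al + u al) = csum N t + csum N u.
Proof. by rewrite /csum big_split. Qed.

Lemma csumZ N (k : R) t : csum N (fun al => k * t al) = k * csum N t.
Proof. by rewrite /csum mulr_sumr. Qed.

Lemma ler_norm_csum N t : `|csum N t| <= csum N (fun al => `|t al|).
Proof. exact: ler_norm_sum. Qed.

Lemma csum_single N (al0 : mindex n) (v : R) : (forall i, (al0 i < N)%N) ->
  csum N (fun al => if al == al0 then v else 0) = v.
Proof.
move=> al0N; pose b0 : {ffun 'I_n -> 'I_N} := [ffun i => Ordinal (al0N i)].
have b0E : cube_index b0 = al0 by apply/ffunP => i; rewrite !ffunE.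
rewrite /csum (bigD1 b0)//= b0E eqxx big1 ?addr0// => b bb0.
by rewrite -b0E (inj_eq (@cube_index_inj N)) (negbTE bb0).
Qed.

Lemma csum_nondecreasing t : (forall al, 0 <= t al) ->
  nondecreasing_seq (csum ^~ t).
Proof.
move=> t0; apply/nondecreasing_seqP => N.
pose h (b : {ffun 'I_n -> 'I_N}) : {ffun 'I_n -> 'I_N.+1} :=
  [ffun i => widen_ord (leqnSn N) (b i)].
have hE b : cube_index (h b) = cube_index b by apply/ffunP => i; rewrite !ffunE.
have hinj : injective h.
  by move=> b b' /(congr1 (@cube_index _)); rewrite !hE => /cube_index_inj.
rewrite /csum (eq_bigr (fun b => t (cube_index (h b)))); last by move=> b _; rewrite hE.
have -> : \sum_b t (cube_index (h b)) =
    \sum_(b in [set h b | b in [set: {ffun 'I_n -> 'I_N}]]%SET) t (cube_index b).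
  rewrite big_imset/=; last by move=> ? ? _ _; exact: hinj.
  by apply: eq_bigl => b; rewrite finset.in_setT.
rewrite [leRHS](bigID (mem [set h b | b in [set: {ffun 'I_n -> 'I_N}]]%SET))/=.
by rewrite lerDl sumr_ge0.
Qed.

(** Both [|t| + t] and [|t|] are nonnegative with partial sums at most [2 * B], so their partial
    sums converge by monotonicity; [t] is their difference. *)
Lemma csum_is_cvg t (B : R) : (forall N, csum N (fun al => `|t al|) <= B) ->
  cvgn (csum ^~ t).
Proof.
move=> tB.
have cvg_nneg u : (forall al, 0 <= u al <= 2 * `|t al|) -> cvgn (csum ^~ u).
  move=> u0; apply: nondecreasing_is_cvgn.
    by apply: csum_nondecreasing => al; have /andP[] := u0 al.
  exists (2 * B) => _ [N _ <-].
  apply: le_trans (ler_wpM2l _ (tB N)) => //; rewrite -csumZ; apply: le_csum => al.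
  by have /andP[] := u0 al.
have tE : csum ^~ t = (csum ^~ (fun al => `|t al| + t al) - csum ^~ (fun al => `|t al|)).
  apply/funext => N.
  have -> : csum N t = csum N (fun al => `|t al| + t al) - csum N (fun al => `|t al|).
    by rewrite -csumB; apply: eq_csum => al; rewrite addrAC subrr add0r.
  by [].
rewrite tE; apply: is_cvgB; apply: cvg_nneg => al.
  by have := ler_norm (t al); have := lerNnormlW (lexx `|t al|); lra.
by have := normr_ge0 (t al); lra.
Qed.

Lemma csum_summable t : summable [set: mindex n] (fun al => (t al)%:E) ->
  exists B : R, forall N, csum N (fun al => `|t al|) <= B.
Proof.
rewrite /summable.
have -> : (\esum_(al in [set: mindex n]) `|(t al)%:E| =
           \esum_(al in [set: mindex n]) (`|t al|)%:E)%E by [].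
move=> fin.
have ge0 : (0 <= \esum_(al in [set: mindex n]) (`|t al|)%:E)%E.
  by apply: esum_ge0 => al _; rewrite lee_fin.
exists (fine (\esum_(al in [set: mindex n]) (`|t al|)%:E)%E) => N.
rewrite -lee_fin fineK ?ge0_fin_numE//.
apply: esum_ge; exists (range (@cube_index N)).
  by split=> //; exact: finite_image.
rewrite fsbig_image//=; last by move=> ? ? _ _; exact: cube_index_inj.
rewrite (_ : [set: _] = [set` index_enum {ffun 'I_n -> 'I_N}]); last first.
  by apply/seteqP; split => x //= _; rewrite mem_index_enum.
by rewrite -fsbig_seq ?index_enum_uniq// /csum -sumEFin.
Qed.

End CubeSums.

(** * Estimates for differences of monomials *)

Section Monomials.
Context {R : realType} {n : nat}.
Implicit Types (u v : 'rV[R]_n) (al : mindex n).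

Lemma coord_le_norm u i : `|u 0 i| <= `|u|.
Proof.
rewrite [leRHS]/Num.norm/= mx_normrE.
by apply/bigmax_geP; right => /=; exists (0, i).
Qed.

Lemma norm_le_coord u (r : R) : 0 <= r -> (forall i, `|u 0 i| <= r) -> `|u| <= r.
Proof.
move=> r0 ur; rewrite [leLHS]/Num.norm/= mx_normrE.
by apply/bigmax_leP; split=> // -[i j] _ /=; rewrite ord1.
Qed.

Lemma norm_lt_coord u (r : R) : 0 < r -> (forall i, `|u 0 i| < r) -> `|u| < r.
Proof.
move=> r0 ur; rewrite [ltLHS]/Num.norm/= mx_normrE.
by apply/bigmax_ltP; split=> // -[i j] _ /=; rewrite ord1.
Qed.

(** Follows from [k ^ 2 <= 2 ^ k.+1]. Halving the radius absorbs the factors [k] and [k ^ 2] that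
    differences and derivatives of monomials produce. *)
Lemma sqr_natr_halfX (r : R) k : 0 <= r ->
  k%:R ^+ 2 * (r / 2) ^+ k <= 2 * r ^+ k.
Proof.
move=> r0; rewrite expr_div_n mulrA mulrAC.
apply: ler_wpM2r; first exact: exprn_ge0.
rewrite ler_pdivrMr ?exprn_gt0// -exprS -!natrX ler_nat.
elim: k => // -[|[|[|k]]] // ih.
rewrite [leqRHS]expnS; apply: leq_trans (leq_mul (leqnn 2) ih).
rewrite !expnS !expn0 !muln1; nia.
Qed.

(** The usual bound with [rho ^+ k.-1] is multiplied by [rho] on both sides, so that neither [k = 0]
    nor [rho = 0] is special. *)
Lemma exprB_le (rho a b : R) k : `|a| <= rho -> `|b| <= rho ->
  rho * `|a ^+ k - b ^+ k| <= k%:R * rho ^+ k * `|a - b|.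
Proof.
move=> arho brho; have rho0 : 0 <= rho by exact: le_trans arho.
elim: k => [|k ih]; first by rewrite !expr0 subrr normr0 mulr0 !mul0r.
have -> : a ^+ k.+1 - b ^+ k.+1 = a * (a ^+ k - b ^+ k) + (a - b) * b ^+ k.
  by rewrite !exprS; ring.
have H1 : rho * `|a * (a ^+ k - b ^+ k)| <= rho * (k%:R * rho ^+ k * `|a - b|).
  rewrite normrM mulrCA; apply: ler_pM => //; exact: mulr_ge0.
have H2 : rho * `|(a - b) * b ^+ k| <= rho * (`|a - b| * rho ^+ k).
  by rewrite normrM normrX; do 2 apply: ler_wpM2l => //; apply: lerXn2r; rewrite ?nnegrE.
have := ler_normD (a * (a ^+ k - b ^+ k)) ((a - b) * b ^+ k).
move/(ler_wpM2l rho0)/le_trans; apply.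
rewrite mulrDr; apply: le_trans (lerD H1 H2) _.
by rewrite exprS -natr1 le_eqVlt; apply/orP; left; apply/eqP; ring.
Qed.

(** Second-order counterpart of [exprB_le], multiplied by [rho ^+ 2]. The constant [k ^ 2] passes
    the induction because [k ^ 2 + k <= k.+1 ^ 2]. *)
Lemma exprB_linear_le (rho a b : R) k : `|a| <= rho -> `|b| <= rho ->
  rho ^+ 2 * `|a ^+ k - b ^+ k - k%:R * b ^+ k.-1 * (a - b)| <=
  k%:R ^+ 2 * rho ^+ k * (a - b) ^+ 2.
Proof.
move=> arho brho; have rho0 : 0 <= rho by exact: le_trans arho.
elim: k => [|k ih].
  by rewrite !expr0 subrr !mul0r subrr normr0 mulr0 expr0n/= !mul0r.
have -> : a ^+ k.+1 - b ^+ k.+1 - k.+1%:R * b ^+ k.+1.-1 * (a - b) =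
    a * (a ^+ k - b ^+ k - k%:R * b ^+ k.-1 * (a - b))
    + k%:R * b ^+ k.-1 * (a - b) ^+ 2.
  case: k {ih} => [|k] /=; first by rewrite !expr0 !expr1; ring.
  by rewrite -!natr1 !exprS; ring.
have H1 : rho ^+ 2 * `|a * (a ^+ k - b ^+ k - k%:R * b ^+ k.-1 * (a - b))|
    <= rho * (k%:R ^+ 2 * rho ^+ k * (a - b) ^+ 2).
  by rewrite normrM mulrCA; apply: ler_pM => //; rewrite mulr_ge0// exprn_ge0.
have H2 : rho ^+ 2 * `|k%:R * b ^+ k.-1 * (a - b) ^+ 2|
    <= k%:R * rho ^+ k.+1 * (a - b) ^+ 2.
  rewrite normrM (ger0_norm (sqr_ge0 _)) normrM normr_nat mulrA.
  apply: ler_wpM2r; first exact: sqr_ge0.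
  rewrite mulrCA.
  case: k {ih H1} => [|k] /=; first by rewrite !mul0r.
    apply: ler_wpM2l => //; rewrite normrX -[k.+2]/(2 + k)%N exprD.
  apply: ler_wpM2l; first exact: exprn_ge0.
  by apply: lerXn2r; rewrite ?nnegrE.
have := ler_normD (a * (a ^+ k - b ^+ k - k%:R * b ^+ k.-1 * (a - b)))
  (k%:R * b ^+ k.-1 * (a - b) ^+ 2).
move/(ler_wpM2l (exprn_ge0 2 rho0))/le_trans; apply.
rewrite mulrDr; apply: le_trans (lerD H1 H2) _.
rewrite mulrA -mulrDl; apply: ler_wpM2r; first exact: sqr_ge0.
rewrite mulrCA -exprS -mulrDl; apply: ler_wpM2r; first exact: exprn_ge0.
by rewrite -natrX -natrD -natrX ler_nat; nia.
Qed.

(** Exponent left by the [i]-th partial derivative. If [al i = 0] the predecessor stays 0,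
    harmlessly: the monomial then comes with the coefficient [al i]. *)
Definition decr_at (i : 'I_n) al : mindex n :=
  [ffun j => if j == i then (al j).-1 else al j].

Lemma mdegree_ge al i : (al i <= mdegree al)%N.
Proof. by rewrite /mdegree (bigD1 i)//= leq_addr. Qed.

Lemma norm_monomial_le (rho : R) u al : (forall i, `|u 0 i| <= rho) ->
  `|monomial al u| <= rho ^+ mdegree al.
Proof.
move=> urho; rewrite /monomial /mdegree normr_prod -prodrXr.
apply: ler_prod => i _; rewrite normr_ge0 normrX/=.
by apply: lerXn2r; rewrite ?nnegrE//; exact: le_trans (urho i).
Qed.

Lemma monomial_const (rho : R) al : monomial al (const_mx rho) = rho ^+ mdegree al.
Proof. by rewrite /monomial /mdegree -prodrXr; apply: eq_bigr => i _; rewrite mxE. Qed.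

(** Telescoping over the variables, one factor changing at a time; the induction is on the list of
    indices of the product. *)
Lemma monomialB_le (rho : R) u v al :
  (forall i, `|u 0 i| <= rho) -> (forall i, `|v 0 i| <= rho) ->
  rho * `|monomial al u - monomial al v| <=
    (mdegree al)%:R * rho ^+ mdegree al * `|u - v|.
Proof.
move=> urho vrho; rewrite /monomial /mdegree.
elim: (index_enum _) => [|i s ih].
  by rewrite !big_nil subrr normr0 mulr0 !mul0r.
rewrite !big_cons.
set a := u 0 i; set b := v 0 i; set P := \prod_(j <- s) _ in ih *.
set Q := \prod_(j <- s) _ in ih *; set d := (\sum_(j <- s) _)%N in ih *.
have rho0 : 0 <= rho by exact: le_trans (urho i).
have Prho : `|P| <= rho ^+ d.
  rewrite /P /d normr_prod -prodrXr; apply: ler_prod => j _.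
  by rewrite normr_ge0 normrX/=; apply: lerXn2r; rewrite ?nnegrE.
have -> : a ^+ al i * P - b ^+ al i * Q =
    (a ^+ al i - b ^+ al i) * P + b ^+ al i * (P - Q) by ring.
have H1 : rho * `|(a ^+ al i - b ^+ al i) * P| <=
    (al i)%:R * rho ^+ al i * `|u - v| * rho ^+ d.
  rewrite normrM mulrA; apply: ler_pM => //; first exact: mulr_ge0.
  apply: le_trans (exprB_le _ (urho i) (vrho i)) _.
  apply: ler_wpM2l; first by rewrite mulr_ge0// exprn_ge0.
  by have := coord_le_norm (u - v) i; rewrite !mxE.
have H2 : rho * `|b ^+ al i * (P - Q)| <= rho ^+ al i * (d%:R * rho ^+ d * `|u - v|).
  rewrite normrM mulrCA; apply: ler_pM => //; first exact: mulr_ge0.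
  by rewrite normrX; apply: lerXn2r; rewrite ?nnegrE//; exact: vrho.
have := ler_normD ((a ^+ al i - b ^+ al i) * P) (b ^+ al i * (P - Q)).
move/(ler_wpM2l rho0)/le_trans; apply.
rewrite mulrDr; apply: le_trans (lerD H1 H2) _.
by rewrite exprD natrD le_eqVlt; apply/orP; left; apply/eqP; ring.
Qed.

Lemma monomial_shift_le (rho : R) u (h : R) (i : 'I_n) al :
  (forall j, `|u 0 j| <= rho) -> `|u 0 i + h| <= rho ->
  rho ^+ 2 * `|monomial al (u + h *: delta_mx 0 i) - monomial al u -
      h * ((al i)%:R * monomial (decr_at i al) u)| <=
    (al i)%:R ^+ 2 * rho ^+ mdegree al * h ^+ 2.
Proof.
move=> urho uhrho; have rho0 : 0 <= rho by exact: le_trans (urho i).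
rewrite /monomial /mdegree (bigD1 i)//= [\prod_i u 0 i ^+ _](bigD1 i)//=.
rewrite [\prod_i0 u 0 i0 ^+ decr_at _ _ _](bigD1 i)//=.
rewrite [(\sum_i0 al i0)%N](bigD1 i)//=.
rewrite (eq_bigr (fun j => u 0 j ^+ al j)); last first.
  by move=> j ji; rewrite !mxE eqxx/= (negbTE ji) mulr0 addr0.
rewrite [\prod_(i0 | i0 != i) u 0 i0 ^+ decr_at _ _ _](eq_bigr (fun j => u 0 j ^+ al j)); last first.
  by move=> j ji; rewrite ffunE (negbTE ji).
rewrite !mxE !eqxx/= mulr1 ffunE eqxx.
set P := \prod_(j | _) _; set d := (\sum_(j | _) _)%N.
have Prho : `|P| <= rho ^+ d.
  rewrite /P /d normr_prod -prodrXr; apply: ler_prod => j _.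
  by rewrite normr_ge0 normrX/=; apply: lerXn2r; rewrite ?nnegrE.
have := exprB_linear_le (al i) uhrho (urho i).
rewrite [u 0 i + h - _]addrAC subrr add0r => H.
have -> : (u 0 i + h) ^+ al i * P - u 0 i ^+ al i * P -
    h * ((al i)%:R * (u 0 i ^+ (al i).-1 * P)) =
  ((u 0 i + h) ^+ al i - u 0 i ^+ al i - (al i)%:R * u 0 i ^+ (al i).-1 * h) * P by ring.
rewrite normrM mulrA exprD mulrA [leRHS]mulrAC; apply: ler_pM => //.
by rewrite mulr_ge0// exprn_ge0.
Qed.

End Monomials.

(** * Power series: bounds, termwise differentiation, Taylor coefficients *)

Section PowerSeries.
Context {R : realType} {n : nat}.
Implicit Types (f : 'rV[R]_n -> R) (a x y : 'rV[R]_n) (al : mindex n).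

Lemma lim_norm_le (u : nat -> R) (l K : R) : u @ \oo --> l ->
  (forall N, `|u N| <= K) -> `|l| <= K.
Proof.
by move=> /cvg_norm ul uK; apply: (cvgr_to_le ul); apply: nearW => N; exact: uK.
Qed.

(* The exponents [e] are kept free, so that differentiating termwise changes
   [c] and [e] but needs no reindexing of the cubes. *)
Definition expands f a (c : mindex n -> R) (e : mindex n -> mindex n) (r B : R) :=
  [/\ 0 < r, forall N, csum N (fun al => `|c al| * r ^+ mdegree (e al)) <= B
    & forall x, `|x - a| < r ->
      (fun N => csum N (fun al => c al * monomial (e al) (x - a))) @ \oo --> f x].

(** At the corner [a + const_mx (r / 2)] every monomial equals [(r / 2) ^+ mdegree al], its largest
    value on the sup-norm cube of that radius. Summability at this single point thus bounds the
    series on the whole cube. *)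
Lemma analytic_at_expands f a : analytic_at f a ->
  exists (c : mindex n -> R) (r B : R), expands f a c id r B.
Proof.
move=> [c] /nbhs_normP/= [_/posnumP[r] near_a].
have r20 : 0 < r%:num / 2 by [].
pose x0 := a + const_mx (r%:num / 2).
have x0r : ball_ (@Num.norm _ 'rV[R]_n) a r%:num x0.
  rewrite /ball_ /= /x0 opprD addNKr normrN.
  apply: norm_lt_coord => // i; rewrite mxE ger0_norm ?ltW//; lra.
have [/csum_summable [B cB] _] := near_a _ x0r.
exists c, (r%:num / 2), B; split => // [N|x xa].
  apply: le_trans (cB N); apply: le_csum => al.
  by rewrite /x0 addrAC subrr add0r normrM monomial_const normrX (ger0_norm (ltW r20)).
have [|_ H] := near_a x; last exact: H.
rewrite /ball_ /= distrC; lra.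
Qed.

Section Expansion.
Context {f : 'rV[R]_n -> R} {a : 'rV[R]_n} {c : mindex n -> R}
  {e : mindex n -> mindex n} {r B : R}.
Hypothesis fE : expands f a c e r B.

Lemma expands_le r' : 0 < r' -> r' <= r -> expands f a c e r' B.
Proof.
have [r0 cB fc] := fE => r'0 r'r; split => // [N|x xa]; last first.
  by apply: fc; exact: lt_le_trans r'r.
apply: le_trans (cB N); apply: le_csum => al.
by apply: ler_wpM2l => //; apply: lerXn2r; rewrite ?nnegrE// ltW.
Qed.

Lemma expands_bound x : `|x - a| < r -> `|f x| <= B.
Proof.
have [r0 cB fc] := fE => xa; apply: lim_norm_le (fc _ xa) _ => N.
apply: le_trans (ler_norm_csum _ _) _; apply: le_trans (cB N); apply: le_csum => al.
rewrite normrM; apply: ler_wpM2l => //; apply: norm_monomial_le => i.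
by apply: le_trans (ltW xa); exact: coord_le_norm.
Qed.

Lemma expands_bound_ge0 : 0 <= B.
Proof.
have [r0 cB fc] := fE; apply: le_trans (cB 0); apply: sumr_ge0 => b _.
by rewrite mulr_ge0// exprn_ge0// ltW.
Qed.

Lemma expands_lipschitz x y : `|x - a| < r / 2 -> `|y - a| < r / 2 ->
  `|f x - f y| <= 4 * B / r * `|x - y|.
Proof.
have [r0 cB fc] := fE => xa ya.
have xar : `|x - a| < r by lra.
have yar : `|y - a| < r by lra.
have lim_xy : (fun N => csum N (fun al => c al * monomial (e al) (x - a))
    - csum N (fun al => c al * monomial (e al) (y - a))) @ \oo --> f x - f y.
  exact: cvgB (fc _ xar) (fc _ yar).
apply: lim_norm_le lim_xy _ => N.
rewrite -csumB.
apply: le_trans (ler_norm_csum _ _) _.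
(* The constant [4 / r] is the 2 of [sqr_natr_halfX] divided by the radius [r / 2] used in
   [monomialB_le]. *)
apply: le_trans (_ : csum N (fun al => (4 / r * `|x - y|) * (`|c al| * r ^+ mdegree (e al))) <= _).
  apply: le_csum => al; rewrite -mulrBr normrM [leRHS]mulrCA.
  apply: ler_wpM2l => //.
  have xi i : `|(x - a) 0 i| <= r / 2 by apply: le_trans (ltW xa); exact: coord_le_norm.
  have yi i : `|(y - a) 0 i| <= r / 2 by apply: le_trans (ltW ya); exact: coord_le_norm.
  have := monomialB_le (e al) xi yi.
  rewrite (_ : x - a - (y - a) = x - y); last by rewrite opprB addrA subrK.
  set m := `|monomial _ _ - _| => H.
  have H2 : (mdegree (e al))%:R * (r / 2) ^+ mdegree (e al) <= 2 * r ^+ mdegree (e al).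
    apply: le_trans (sqr_natr_halfX _ (ltW r0)); apply: ler_wpM2r.
      by rewrite exprn_ge0// ltW// divr_gt0.
    by rewrite -natrX ler_nat; case: mdegree => // k; rewrite leq_pmulr.
  have := le_trans H (ler_wpM2r (normr_ge0 _) H2).
  rewrite -ler_pdivlMl; last lra.
  move/le_trans; apply; rewrite le_eqVlt; apply/orP; left; apply/eqP.
  by field; rewrite gt_eqF.
rewrite csumZ [leRHS]mulrAC [leRHS]mulrAC -!mulrA [B * _]mulrC !mulrA.
by apply: ler_wpM2l (cB N); rewrite mulr_ge0// divr_ge0// ltW.
Qed.

Lemma expands_continuous x : `|x - a| < r / 2 -> {for x, continuous f}.
Proof.
have [r0 _ _] := fE => xa.
have B0 := expands_bound_ge0.
apply: (iffRL (@cvgrPdist_le _ _ _ (nbhs x) _ f (f x))) => eps eps0.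
pose K := 4 * B / r + 1.
have K0 : 0 < K by rewrite ltr_wpDl// divr_ge0// ?mulr_ge0// ltW.
have m0 : 0 < Num.min (r / 2 - `|x - a|) (eps / K) by rewrite lt_min subr_gt0 xa/= divr_gt0.
apply: (@filterS _ (nbhs x)) (nbhsx_ballx x _ m0) => y.
rewrite -ball_normE /ball_/= lt_min  => /andP[xy1 xy2].
apply: le_trans (expands_lipschitz xa _) _.
  rewrite (_ : y - a = (x - a) - (x - y)); last by rewrite opprB [RHS]addrC addrA subrK.
  by apply: le_lt_trans (ler_normB _ _) _; rewrite addrC -ltrBrDr.
apply: le_trans (_ : K * `|x - y| <= _).
  by apply: ler_wpM2r => //; rewrite lerDl.
by rewrite -ler_pdivlMl// mulrC ltW.
Qed.

Lemma expands_pderiv_bound (i : 'I_n) N :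
  csum N (fun al => `|c al * (e al i)%:R| * (r / 2) ^+ mdegree (decr_at i (e al)))
    <= 4 / r * B.
Proof.
have [r0 cB _] := fE.
have r20 : 0 < r / 2 by rewrite divr_gt0.
apply: le_trans (ler_wpM2l _ (cB N)); last by rewrite divr_ge0// ltW.
rewrite -csumZ; apply: le_csum => al.
rewrite normrM normr_nat -mulrA [leRHS]mulrCA; apply: ler_wpM2l => //.
have [->|ei0] := eqVneq (e al i) 0%N.
  by rewrite mul0r mulr_ge0 ?exprn_ge0 ?divr_ge0// ltW.
have -> : mdegree (e al) = (mdegree (decr_at i (e al))).+1.
  rewrite /mdegree (bigD1 i)//= [in RHS](bigD1 i)//= ffunE eqxx -addSn prednK ?lt0n//.
  by congr addn; apply: eq_bigr => j ji; rewrite ffunE (negbTE ji).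
set k := mdegree _.
have H2 := sqr_natr_halfX k.+1 (ltW r0).
have H3 : (e al i)%:R <= k.+1%:R ^+ 2 :> R.
  rewrite -natrX ler_nat; apply: (@leq_trans k.+1); last by rewrite leq_pmulr.
  rewrite /k /mdegree (bigD1 i)//= ffunE eqxx.
  by rewrite -addSn prednK ?lt0n// leq_addr.
rewrite -(ler_pM2l r20) mulrCA -exprS.
apply: le_trans (_ : 2 * r ^+ k.+1 <= _); last first.
  by rewrite le_eqVlt; apply/orP; left; apply/eqP; field; rewrite gt_eqF.
by apply: le_trans H2; apply: ler_wpM2r => //; rewrite exprn_ge0// ltW.
Qed.

(** The second-order estimate [monomial_shift_le] holds for the partial sums with a constant
    independent of [N], so it survives the limit: the increment of [f] differs from [h * D] by at
    most [K * h ^+ 2]. This replaces any interchange of limits. The 8 in [K] is the 2 of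
    [sqr_natr_halfX] divided by [(1 / 2) ^+ 2]. *)
Lemma expands_pderiv_at (i : 'I_n) x : `|x - a| < r / 2 ->
  derivable f x (delta_mx 0 i) /\
  (fun N => csum N (fun al => c al * (e al i)%:R * monomial (decr_at i (e al)) (x - a)))
    @ \oo --> pderiv i f x.
Proof.
have [r0 cB fc] := fE => xa; set t := fun al => _.
have B0 := expands_bound_ge0.
have r20 : 0 < r / 2 by rewrite divr_gt0.
have xar : `|x - a| < r by lra.
have xi j : `|(x - a) 0 j| <= r / 2 by apply: le_trans (ltW xa); exact: coord_le_norm.
have tB N : csum N (fun al => `|t al|) <= 4 / r * B.
  apply: le_trans (expands_pderiv_bound i N); apply: le_csum => al.
  by rewrite normrM; apply: ler_wpM2l => //; exact: norm_monomial_le.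
have [D tD] : exists D : R, (fun N => csum N t) @ \oo --> D.
  by have /cvg_ex := csum_is_cvg tB.
pose K := 8 * B / r ^+ 2.
have K0 : 0 <= K by rewrite divr_ge0 ?mulr_ge0 ?exprn_ge0// ltW.
have est (h : R) : `|h| < r / 2 - `|x - a| ->
    `|f (x + h *: delta_mx 0 i) - f x - h * D| <= K * h ^+ 2.
  move=> hx.
  have nd : `|h *: (delta_mx 0 i : 'rV[R]_n)| <= `|h|.
    apply: norm_le_coord => // j; rewrite !mxE eqxx/=.
    by case: (j == i); rewrite ?mulr1 ?mulr0 ?normr0.
  have xha2 : `|x + h *: delta_mx 0 i - a| < r / 2.
    rewrite addrAC; apply: le_lt_trans (ler_normD _ _) _.
    by rewrite -ltrBrDl; exact: le_lt_trans nd hx.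
  have xha : `|x + h *: delta_mx 0 i - a| < r by lra.
  have uhi : `|(x - a) 0 i + h| <= r / 2.
    apply: le_trans (ltW xha2); apply: le_trans (coord_le_norm _ i).
    by rewrite !mxE !eqxx/= mulr1 addrAC.
  have lim_h : (fun N =>
      csum N (fun al => c al * monomial (e al) (x + h *: delta_mx 0 i - a))
      - csum N (fun al => c al * monomial (e al) (x - a)) - h * csum N t) @ \oo
      --> f (x + h *: delta_mx 0 i) - f x - h * D.
    exact: cvgB (cvgB (fc _ xha) (fc _ xar)) (cvgM (cvg_cst h) tD).
  apply: lim_norm_le lim_h _ => N.
  rewrite -csumZ -!csumB.
  apply: le_trans (ler_norm_csum _ _) _.
  apply: le_trans (_ : csum N (fun al => (8 / r ^+ 2 * h ^+ 2) * (`|c al| * r ^+ mdegree (e al))) <= _).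
    apply: le_csum => al.
    rewrite /t (_ : _ - _ - _ = c al * (monomial (e al) (x - a + h *: delta_mx 0 i)
      - monomial (e al) (x - a)
      - h * ((e al i)%:R * monomial (decr_at i (e al)) (x - a)))); last first.
      by rewrite (addrAC x); ring.
    rewrite normrM [leRHS]mulrCA; apply: ler_wpM2l => //.
    have := monomial_shift_le (e al) xi uhi.
    set m := `|monomial _ _ - _ - _| => H.
    have H2 : (e al i)%:R ^+ 2 * (r / 2) ^+ mdegree (e al) <= 2 * r ^+ mdegree (e al).
      apply: le_trans (sqr_natr_halfX _ (ltW r0)); apply: ler_wpM2r.
        by rewrite exprn_ge0// ltW.
      by rewrite -!natrX ler_nat leq_exp2r// mdegree_ge.
    have := le_trans H (ler_wpM2r (sqr_ge0 h) H2).
    rewrite -ler_pdivlMl ?exprn_gt0//.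
    move/le_trans; apply; rewrite le_eqVlt; apply/orP; left; apply/eqP.
    by field; rewrite gt_eqF.
  rewrite csumZ /K (_ : 8 * B / r ^+ 2 * h ^+ 2 = 8 / r ^+ 2 * h ^+ 2 * B); last by ring.
  by apply: ler_wpM2l (cB N); rewrite mulr_ge0 ?divr_ge0 ?sqr_ge0.
have quot : (fun h => h^-1 *: ((f \o shift x) (h *: delta_mx 0 i) - f x)) @ (0 : R)^' --> D.
  apply/cvgrPdist_le => /= eps eps0.
  near=> h.
  have h0 : h != 0 by near: h; exact: nbhs_dnbhs_neq.
  have hx : `|h| < r / 2 - `|x - a| by near: h; apply: dnbhs0_lt; rewrite subr_gt0.
  have heps : `|h| < eps / (K + 1).
    by near: h; apply: dnbhs0_lt; rewrite divr_gt0// ltr_wpDl.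
  rewrite distrC (_ : _ - D = h^-1 * (f (x + h *: delta_mx 0 i) - f x - h * D)); last first.
    by rewrite /= [_ + x]addrC [_ *: _]/(_ * _) [in RHS]mulrBr mulKf.
  rewrite normrM normfV -(ler_pM2l (_ : 0 < `|h|)) ?normr_gt0// mulVKf ?normr_eq0//.
  apply: le_trans (est _ hx) _; rewrite -(real_normK (num_real h)) expr2 mulrCA.
  apply: ler_wpM2l => //.
  apply: le_trans (_ : (K + 1) * `|h| <= _); first by apply: ler_wpM2r => //; lra.
  by rewrite -ler_pdivlMl ?ltr_wpDl// mulrC ltW.
split; first by apply/cvg_ex; exists D.
by rewrite /pderiv /derive (cvg_lim _ quot).
Unshelve. all: by end_near. Qed.

End Expansion.

Lemma expands_pderiv f a c e r B (i : 'I_n) : expands f a c e r B ->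
  expands (pderiv i f) a (fun al => c al * (e al i)%:R) (fun al => decr_at i (e al))
    (r / 2) (4 / r * B).
Proof.
move=> fE; have [r0 _ _] := fE; split; first by rewrite divr_gt0.
  exact: expands_pderiv_bound fE i.
by move=> x xa; have [] := expands_pderiv_at fE i xa.
Qed.

(** Each point is the centre of its own expansion. Every derivative halves the radius, but it
    remains positive after finitely many, which is all that continuity and derivability at the
    centre require. *)
Lemma analytic_smooth_on (V : set 'rV[R]_n) f :
  (forall x, V x -> analytic_at f x) -> smooth_on V f.
Proof.
move=> fV s x Vx.
have [c [e [r [B fE]]]] : exists c e r B, expands (foldr (@pderiv _ n) f s) x c e r B.
  elim: s => [|i s [c [e [r [B ih]]]]] /=.
    by have [c [r [B ?]]] := analytic_at_expands (fV _ Vx); exists c, id, r, B.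
  by eexists _, _, _, _; exact: expands_pderiv ih.
have [r0 _ _] := fE.
have xx : `|x - x| < r / 2 by rewrite subrr normr0 divr_gt0.
split; first exact: expands_continuous fE _ xx.
by move=> i; have [] := expands_pderiv_at fE i xx.
Qed.

(** The truncated subtraction is harmless: whenever it truncates, the falling factorial in the
    coefficient is 0. *)
Lemma expands_iter_pderiv f a c e r B (i : 'I_n) k : expands f a c e r B ->
  exists r' B', expands (iter k (pderiv i) f) a
    (fun al => c al * (e al i ^_ k)%:R)
    (fun al => [ffun j => e al j - (if j == i then k else 0)]%N) r' B'.
Proof.
move=> fE; elim: k => [|k [r' [B' ih]]].
  exists r, B; congr (expands f a _ _ r B): fE; apply/funext => al.
    by rewrite ffactn0 mulr1.
  by apply/ffunP => j; rewrite ffunE if_same subn0.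
have := expands_pderiv i ih => ih'; eexists _, _.
congr (expands _ a _ _ _ _): ih'; apply/funext => al.
  by rewrite !ffunE eqxx -mulrA -natrM ffactnSr.
by apply/ffunP => j; rewrite !ffunE; case: eqP => // _; rewrite -subnS.
Qed.

Lemma expands_mderiv f a c e r B (al : mindex n) : expands f a c e r B ->
  exists r' B', expands (mderiv al f) a
    (fun be => c be * \prod_i (e be i ^_ al i)%:R)
    (fun be => [ffun i => e be i - al i]%N) r' B'.
Proof.
move=> fE.
(* Generalised to a duplicate-free list of coordinates, so that each exponent is lowered exactly
   once. *)
have [r' [B' H]] : exists r' B',
    expands (foldr (fun i h => iter (al i) (pderiv i) h) f (enum 'I_n)) a
    (fun be => c be * \prod_(i <- enum 'I_n) (e be i ^_ al i)%:R)
    (fun be => [ffun i => e be i - (if i \in enum 'I_n then al i else 0)]%N) r' B'.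
  elim: (enum _) (enum_uniq 'I_n) => [_|i s ih /= /andP[iNs us]].
    exists r, B; congr (expands f a _ _ r B): fE; apply/funext => be.
      by rewrite big_nil mulr1.
    by apply/ffunP => j; rewrite ffunE in_nil subn0.
  have [r' [B' /(expands_iter_pderiv i (al i)) [r1 [B1 ih']]]] := ih us.
  exists r1, B1; congr (expands _ a _ _ _ _): ih'; apply/funext => be.
    by rewrite big_cons ffunE (negbTE iNs) subn0 -mulrA [_ * _%:R in LHS]mulrC.
  apply/ffunP => j; rewrite !ffunE in_cons.
  by case: eqP => [->|_]; rewrite ?(negbTE iNs) ?subn0.
exists r', B'; congr (expands _ a _ _ _ _): H; apply/funext => be.
  by rewrite big_enum.
by apply/ffunP => j; rewrite !ffunE mem_enum.
Qed.

(** In the series of [mderiv al f] at 0 only the term [be = al] survives: if some [be i < al i] a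
    falling factorial vanishes, otherwise some exponent is positive and the monomial vanishes at 0.
    This ties the series to the Newton polyhedron. *)
Lemma taylor_coef_expands f c r B (al : mindex n) : expands f 0 c id r B ->
  taylor_coef f al = c al.
Proof.
move=> /(expands_mderiv al) [r' [B' [r0 _ /(_ 0)]]].
rewrite subrr normr0 => /(_ r0) fc.
have fact0 : (\prod_i (al i)`!)%:R != 0 :> R.
  by rewrite pnatr_eq0 -lt0n prodn_gt0// => i; exact: fact_gt0.
have {}fc : (fun N => csum N (fun be => if be == al then c al * (\prod_i (al i)`!)%:R else 0))
    @ \oo --> mderiv al f 0.
  apply: cvg_trans fc; apply: near_eq_cvg; apply: nearW => N; apply: eq_csum => be.
  case: eqP => [->|/eqP beal].
    rewrite (_ : monomial _ _ = 1) ?mulr1; last first.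
      by rewrite /monomial big1// => i _; rewrite ffunE subnn expr0.
    by rewrite natr_prod; congr (_ * _); apply: eq_bigr => i _; rewrite ffactnn.
  have [i bei] : exists i, be i != al i.
    apply/existsP; rewrite -negb_forall; apply: contra beal => /forallP H.
    by apply/eqP/ffunP => i; exact/eqP.
  have [lt|ge] := ltnP (be i) (al i).
    by rewrite (bigD1 i)//= ffact_small// mul0r mulr0 mul0r.
  rewrite (_ : monomial _ _ = 0) ?mulr0//.
  rewrite /monomial (bigD1 i)//= !mxE ffunE expr0n subn_eq0 leqNgt ltn_neqAle.
  by rewrite eq_sym bei ge/= mul0r.
have : mderiv al f 0 = c al * (\prod_i (al i)`!)%:R.
  rewrite -(cvg_lim _ fc)//; apply: lim_near_cst => //.
  exists (\sum_i al i).+1 => // N /= alN; apply: csum_single => i.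
  by apply: leq_trans alN; rewrite ltnS (bigD1 i)//= leq_addr.
by rewrite /taylor_coef => ->; rewrite mulfK.
Qed.

End PowerSeries.

(** * The power series of H, obtained by removing the affine part of g *)

Section AffineCorrection.
Context {R : realType} {n : nat}.
Implicit Types (k : R) (w x : 'rV[R]_n) (al : mindex n).

(** Coefficients of the power series of [k + dot w x] about 0. *)
Definition affine_coef k w al : R :=
  (if al == [ffun=> 0%N] then k else 0) +
  \sum_i (if al == [ffun j => nat_of_bool (j == i)] then w 0 i else 0).

Lemma csum_affine_coef N k w (m : mindex n -> R) : (1 < N)%N ->
  csum N (fun al => affine_coef k w al * m al) =
  k * m [ffun=> 0%N] + \sum_i w 0 i * m [ffun j => nat_of_bool (j == i)].
Proof.
move=> N1; rewrite (@eq_csum _ _ _ _ (fun al =>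
    (if al == [ffun=> 0%N] then k * m [ffun=> 0%N] else 0) +
    \sum_i (if al == [ffun j => nat_of_bool (j == i)]
      then w 0 i * m [ffun j => nat_of_bool (j == i)] else 0))); last first.
  move=> al; rewrite /affine_coef mulrDl mulr_suml; congr (_ + _).
    by case: eqP => [->|]; rewrite ?mul0r.
  by apply: eq_bigr => i _; case: eqP => [->|]; rewrite ?mul0r.
rewrite csumD csum_single => [|i]; last by rewrite ffunE; lia.
congr (_ + _); rewrite /csum exchange_big; apply: eq_bigr => i _.
apply: (csum_single (N := N)) => j; rewrite ffunE.
by case: (j == i); lia.
Qed.

Lemma expands_affine k w (r : R) : 0 < r ->
  exists B, expands (fun x => k + dot w x) 0 (affine_coef k w) id r B.
Proof.
move=> r0; exists (`|k| * r ^+ mdegree ([ffun=> 0%N] : mindex n) +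
  \sum_i (\row_j `|w 0 j|) 0 i * r ^+ mdegree ([ffun j => nat_of_bool (j == i)] : mindex n)).
split => // [N|x _].
  (* The cube of side [N + 2] contains the unit multi-indices for every [N]; partial sums of a
     nonnegative family increase with the cube. *)
  rewrite -(@csum_affine_coef (N + 2) _ _ (fun al => r ^+ mdegree al)); last by lia.
  have r_ge0 al : 0 <= r ^+ mdegree al by rewrite exprn_ge0// ltW.
  have abs_le al : `|affine_coef k w al| <= affine_coef `|k| (\row_j `|w 0 j|) al.
    apply: le_trans (ler_normD _ _) _; apply: lerD; first by case: ifP; rewrite ?normr0.
    apply: le_trans (ler_norm_sum _ _ _) _; apply: ler_sum => i _.
    by rewrite mxE; case: ifP; rewrite ?normr0.
  apply: (@le_trans _ _ (csum N (fun al => affine_coef `|k| (\row_j `|w 0 j|) al * r ^+ mdegree al))).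
    by apply: le_csum => al; apply: ler_wpM2r.
  apply: csum_nondecreasing => [al|]; last exact: leq_addr.
  by rewrite mulr_ge0//; exact: le_trans (abs_le al).
apply: cvg_near_cst; exists 2%N => // N /= N2.
rewrite subr0 (csum_affine_coef _ _ _ N2); congr (_ + _).
  by rewrite /monomial big1 ?mulr1// => i _; rewrite ffunE expr0.
apply: eq_bigr => i _; congr (_ * _).
rewrite /monomial (bigD1 i)//= ffunE eqxx expr1 big1 ?mulr1// => j ji.
by rewrite ffunE (negbTE ji) expr0.
Qed.

Lemma expandsB f g (a : 'rV[R]_n) c c' e r B B' : expands f a c e r B ->
  expands g a c' e r B' ->
  expands (fun x => f x - g x) a (fun al => c al - c' al) e r (B + B').
Proof.
move=> [r0 cB fc] [_ cB' gc]; split=> // [N|x xa].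
  apply: le_trans (lerD (cB N) (cB' N)); rewrite -csumD; apply: le_csum => al.
  rewrite -mulrDl; apply: ler_wpM2r; first by rewrite exprn_ge0// ltW.
  exact: ler_normB.
rewrite (_ : (fun N => _) = (fun N => csum N (fun al => c al * monomial (e al) (x - a))
    - csum N (fun al => c' al * monomial (e al) (x - a)))).
  exact: cvgB (fc _ xa) (gc _ xa).
by apply/funext => N; rewrite -csumB; apply: eq_csum => al; rewrite mulrBl.
Qed.

Lemma expands_shift f (z : 'rV[R]_n) c e r B : expands f z c e r B ->
  expands (fun x => f (x + z)) 0 c e r B.
Proof.
move=> [r0 cB fc]; split=> // x; rewrite subr0 => xa.
have := fc (x + z); rewrite addrK; exact.
Qed.

Lemma expands_remainder (g : 'rV[R]_n -> R) (z w : 'rV[R]_n) : analytic_at g z ->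
  exists c r B, expands (fun x => g (x + z) - g z - dot w x) 0 c id r B.
Proof.
move=> /analytic_at_expands[c [r [B /expands_shift gE]]]; have [r0 _ _] := gE.
have [B' aE] := expands_affine (g z) w r0.
exists (fun al => c al - affine_coef (g z) w al), r, (B + B').
have := expandsB gE aE; congr (expands _ 0 _ id r _).
by apply/funext => x; rewrite opprD addrA.
Qed.

End AffineCorrection.

(** * Boxes and surface measure *)

Section Boxes.
Context {R : realType}.

Definition obox n (l u : 'rV[R]_n) : set 'rV[R]_n :=
  [set x | forall i, l 0 i < x 0 i < u 0 i].

Definition volume n (l u : 'rV[R]_n) : R := \prod_i (u 0 i - l 0 i).

(** The integral of a nonnegative function is a supremum over the simple functions below it, hence
    monotone for arbitrary integrands. The nested integrals of [lebesgue_rV] can thus be compared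
    layer by layer. *)
Lemma ge0_le_integral_nomeas d (T : measurableType d)
    (mu : {measure set T -> \bar R}) (f1 f2 : T -> \bar R) :
  (forall x, (0 <= f1 x)%E) -> (forall x, (f1 x <= f2 x)%E) ->
  (\int[mu]_x f1 x <= \int[mu]_x f2 x)%E.
Proof.
move=> f10 f12; have f20 x : (0 <= f2 x)%E by exact: le_trans (f12 x).
rewrite !ge0_integralTE//; apply: le_ereal_sup => _ [h hf1 <-].
by exists h => // x; exact: le_trans (hf1 x) (f12 x).
Qed.

Lemma le_lebesgue_rV n (f1 f2 : 'rV[R]_n -> \bar R) :
  (forall x, (0 <= f1 x)%E) -> (forall x, (f1 x <= f2 x)%E) ->
  (lebesgue_rV f1 <= lebesgue_rV f2)%E.
Proof.
elim: n f1 f2 => [|n ih] f1 f2 f10 f12 /=; first exact: f12.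
apply: ih => x; first by apply: integral_ge0 => t _; exact: f10.
by apply: ge0_le_integral_nomeas => t; [exact: f10|exact: f12].
Qed.

Lemma insert_at n (j : 'I_n.+1) t (x : 'rV[R]_n) : insert j t x 0 j = t.
Proof. by rewrite mxE unlift_none. Qed.

Lemma insert_lift n (j : 'I_n.+1) t (x : 'rV[R]_n) k : insert j t x 0 (lift j k) = x 0 k.
Proof. by rewrite mxE liftK. Qed.

Lemma col'_insert n (j : 'I_n.+1) t (x : 'rV[R]_n) : col' j (insert j t x) = x.
Proof. by apply/rowP => i; rewrite mxE insert_lift. Qed.

Lemma insert_col' n (j : 'I_n.+1) (s : 'rV[R]_n.+1) : insert j (s 0 j) (col' j s) = s.
Proof.
apply/rowP => i; rewrite mxE; case: unliftP => [k ->|->//].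
by rewrite mxE.
Qed.

(** The factor [k] is carried for the induction: integrating one coordinate multiplies it by the
    length of that side. *)
Lemma lebesgue_rV_obox n (k : R) (l u : 'rV[R]_n) : 0 <= k ->
  (forall i, l 0 i <= u 0 i) ->
  lebesgue_rV (fun x => (k * \1_(obox l u) x)%:E) = (k * volume l u)%:E.
Proof.
elim: n k l u => [|n ih] k l u k0 lu.
  rewrite /= /volume big_ord0 indicE mem_set ?mulr1//.
  by case.
rewrite /=; set l' := col' ord0 l; set u' := col' ord0 u.
rewrite (_ : (fun x : 'rV[R]_n => _) =
    (fun x => (k * (u 0 ord0 - l 0 ord0) * \1_(obox l' u') x)%:E)).
  rewrite ih ?mulr_ge0 ?subr_ge0//; last by move=> i; rewrite !mxE.
  rewrite /volume [in RHS]big_ord_recl mulrA; congr (_ * _)%:E.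
  by apply: eq_bigr => i _; rewrite !mxE.
apply/funext => x.
rewrite (_ : (fun t : R => _) = (fun t : R => (k * \1_(obox l' u') x)%:E *
    (\1_(`]l 0 ord0, u 0 ord0[%classic : set R) t)%:E)%E).
  rewrite ge0_integralZl_EFin//; [|exact/measurable_EFinP|by rewrite mulr_ge0].
  rewrite integral_indic// setIT/= lebesgue_measure_itv/= lte_fin.
  have := lu ord0; rewrite le_eqVlt => /predU1P[->|->].
    by rewrite ltxx mule0 subrr mulr0 mul0r.
  by rewrite -EFinB -EFinM mulrAC.
apply/funext => t; rewrite -EFinM -mulrA; congr (k * _)%:E.
rewrite !indicE -natrM mulnb; congr (nat_of_bool _)%:R.
apply/idP/idP => [/set_mem H|/andP[/set_mem H1 /set_mem]].
  apply/andP; split; apply/mem_set.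
    by move=> i; have := H (lift ord0 i); rewrite insert_lift !mxE.
  by rewrite /= in_itv/=; have := H ord0; rewrite insert_at.
rewrite /= in_itv/= => H2; apply/mem_set => i.
case: (unliftP ord0 i) => [j ->|->]; last by rewrite insert_at.
by have := H1 j; rewrite insert_lift !mxE.
Qed.

Lemma obox_open n (l u : 'rV[R]_n) : open (obox l u).
Proof.
rewrite openE => x lxu; apply: (@filter_forall _ _ _ (nbhs x)) => i.
have oi : open ((fun x : 'rV[R]_n => x 0 i) @^-1` `]l 0 i, u 0 i[%classic).
  by apply: open_comp; [move=> x' _; exact: coord_continuous|exact: itv_open].
apply: (@filterS _ (nbhs x)) (open_nbhs_nbhs (conj oi _)) => [x'|]/=.
  by rewrite in_itv.
by rewrite in_itv/=; exact: lxu.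
Qed.

Lemma col'_continuous n (j : 'I_n.+1) :
  continuous (fun s : 'rV[R]_n.+1 => col' j s).
Proof.
move=> s; apply: (iffRL (@cvgrPdist_lt _ _ _ (nbhs s) _ _ _)) => eps eps0.
apply: (@filterS _ (nbhs s)) (nbhsx_ballx s _ eps0) => s'.
rewrite -ball_normE /ball_/= => ss'.
apply: norm_lt_coord => // i; apply: le_lt_trans ss'.
by rewrite !mxE; have := coord_le_norm (s - s') (lift j i); rewrite !mxE.
Qed.

Lemma insert_continuous n (j : 'I_n.+1) (h : 'rV[R]_n -> R) (x : 'rV[R]_n) :
  {for x, continuous h} -> {for x, continuous (fun x => insert j (h x) x)}.
Proof.
move=> hx; apply: (iffRL (@cvgrPdist_lt _ _ _ (nbhs x) _ _ _)) => eps eps0.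
have H1 := iffLR (@cvgrPdist_lt _ _ _ (nbhs x) (nbhs_filter x) h (h x)) hx _ eps0.
apply: (@filterS _ (nbhs x)) (filterI (nbhsx_ballx x _ eps0) H1) => x' [].
rewrite -ball_normE /ball_/= => xx' hxx'.
apply: norm_lt_coord => // i; rewrite !mxE; case: unliftP => [k _|_//].
by apply: le_lt_trans xx'; have := coord_le_norm (x - x') k; rewrite !mxE.
Qed.

Definition cylinder n (Q : set 'rV[R]_n) : set 'rV[R]_n.+1 :=
  [set s | Q (col' ord_max s)].

Lemma cylinder_open n (Q : set 'rV[R]_n) : open Q -> open (cylinder Q).
Proof. by move=> oQ; apply: open_comp => // s _; exact: col'_continuous. Qed.

Lemma open_measurable_rV n (A : set 'rV[R]_n) : open A ->
  measurable (A : set (borel_rV R n)).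
Proof. exact: sub_sigma_algebra. Qed.

Lemma continuous_measurable_rV n (f : 'rV[R]_n -> R) : continuous f ->
  measurable_fun setT (f : borel_rV R n -> R).
Proof.
move=> cf; apply: (measurability _ (RGenOInfty.measurableE R)).
move=> _ [_ [a ->] <-]; rewrite setTI; apply: open_measurable_rV.
by apply: open_comp => [x _|]; [exact: cf|exact: interval_open].
Qed.

(** The graph is the open cylinder over [V] minus the subset where the last coordinate differs from
    [g]. That subset is open because [g] is continuous at the points of [V]. *)
Lemma graph_measurable n (V : set 'rV[R]_n) (g : 'rV[R]_n -> R) : open V ->
  (forall x, V x -> {for x, continuous g}) ->
  measurable (graph ord_max V g : set (borel_rV R n.+1)).
Proof.
move=> oV cg.
pose h (s : 'rV[R]_n.+1) := s 0 ord_max - g (col' ord_max s).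
rewrite (_ : graph _ _ _ = cylinder V `\` (cylinder V `&` [set s | h s != 0])).
  have mV := open_measurable_rV (cylinder_open oV).
  apply: measurableD => //; apply: open_measurable_rV.
  rewrite openE => s [Vs hs].
  have Vnear : \forall s' \near s, cylinder V s'.
    exact: open_nbhs_nbhs (conj (cylinder_open oV) Vs).
  have hcont : {for s, continuous h}.
    apply: continuousB; first exact: coord_continuous.
    apply: (@continuous_comp _ _ _ (fun s : 'rV[R]_n.+1 => col' ord_max s) g).
      exact: col'_continuous.
    exact: cg.
  have hnear : \forall s' \near s, h s' != 0.
    have n0 : nbhs (h s) [set t | t != 0] by apply: open_nbhs_nbhs; split => //; exact: open_neq.
    exact: hcont n0.
  exact: filterI Vnear hnear.
apply/seteqP; split => [_ [x Vx <-]|s [Vs /not_andP[//|]]].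
  split; first by rewrite /cylinder/= col'_insert.
  by move=> [_]; rewrite /= /h insert_at col'_insert subrr eqxx.
rewrite /= => /negP; rewrite negbK subr_eq0 => /eqP sg.
by exists (col' ord_max s) => //; rewrite -sg insert_col'.
Qed.

End Boxes.

(** * Surface measure over boxes of the parameter domain *)

Section SurfaceBoxes.
Context {R : realType} {n : nat} {S : set 'rV[R]_n.+1}
  {sigma : {measure set (borel_rV R n.+1) -> \bar R}}
  {V : set 'rV[R]_n} {g : 'rV[R]_n -> R}.
Hypotheses (hsigma : surface_measure S sigma) (oV : open V) (sg : smooth_on V g)
  (gS : graph ord_max V g `<=` S).

Local Notation G := (graph ord_max V g).

Let mG : measurable (G : set (borel_rV R n.+1)).
Proof. by apply: graph_measurable => // x Vx; have [] := sg [::] Vx. Qed.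

Let mcyl l u : measurable (cylinder (obox l u) : set (borel_rV R n.+1)).
Proof. by apply: open_measurable_rV; exact/cylinder_open/obox_open. Qed.

(** The density [Num.sqrt (1 + dot (grad g x) (grad g x))] is at least 1, so a piece of graph has at
    least the volume of its shadow. *)
Lemma sigma_obox_ge (l u : 'rV[R]_n) : obox l u `<=` V ->
  (forall i, l 0 i <= u 0 i) ->
  ((volume l u)%:E <= sigma (cylinder (obox l u) `&` G))%E.
Proof.
move=> luV lu; have [_ /(_ ord_max V g oV sg gS _ (mcyl l u)) ->] := hsigma.
rewrite -[volume _ _]mul1r -(lebesgue_rV_obox ler01 lu).
apply: le_lebesgue_rV => x; first by rewrite lee_fin mulr_ge0.
rewrite lee_fin mul1r (_ : \1_(cylinder (obox l u)) _ = \1_(obox l u) x); last first.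
  by rewrite !indicE; congr (nat_of_bool _)%:R; apply/idP/idP => /set_mem H;
    apply/mem_set; move: H; rewrite /cylinder/= col'_insert.
have [xlu|xlu] := pselect (obox l u x); last first.
  have -> : \1_(obox l u) x = 0 :> R by rewrite indicE memNset.
  by rewrite mulr0 mul0r.
rewrite !indicE !mem_set//; last exact: luV.
rewrite !mul1r -[leLHS]sqrtr1; apply: ler_wsqrtr.
by rewrite lerDl sumr_ge0// => i _; rewrite -expr2 sqr_ge0.
Qed.

Lemma sigma_obox_fin (l u : 'rV[R]_n) (C : R) : (forall i, l 0 i <= u 0 i) ->
  (forall x, V x -> obox l u x -> Num.sqrt (1 + dot (grad g x) (grad g x)) <= C) ->
  (sigma (cylinder (obox l u) `&` G) < +oo)%E.
Proof.
move=> lu bC; have [_ /(_ ord_max V g oV sg gS _ (mcyl l u)) ->] := hsigma.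
(* The bound concerns only points of the box in [V]; if there are none, [C] may be negative. *)
have C0 : 0 <= Num.max C 0 by rewrite le_max lexx orbT.
apply: le_lt_trans (ltry (Num.max C 0 * volume l u)).
rewrite -(lebesgue_rV_obox C0 lu).
apply: le_lebesgue_rV => x; first by rewrite lee_fin !mulr_ge0// sqrtr_ge0.
rewrite lee_fin (_ : \1_(cylinder (obox l u)) _ = \1_(obox l u) x); last first.
  by rewrite !indicE; congr (nat_of_bool _)%:R; apply/idP/idP => /set_mem H;
    apply/mem_set; move: H; rewrite /cylinder/= col'_insert.
have [xlu|xlu] := pselect (obox l u x); last first.
  have -> : \1_(obox l u) x = 0 :> R by rewrite indicE memNset.
  by rewrite !mulr0 mul0r.
have [Vx|Vx] := pselect (V x); last first.
  have -> : \1_V x = 0 :> R by rewrite indicE memNset.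
  by rewrite !mul0r mulr_ge0.
rewrite !indicE !mem_set// !mul1r mulr1 le_max; apply/orP; left; exact: bC.
Qed.

Lemma sigma_boxes_ge (I : finType) (l u : I -> 'rV[R]_n)
    (A : set (borel_rV R n.+1)) : measurable A ->
  (forall a, obox (l a) (u a) `<=` V) -> (forall a i, l a 0 i <= u a 0 i) ->
  (forall a b, a != b -> obox (l a) (u a) `&` obox (l b) (u b) = set0) ->
  (forall a x, obox (l a) (u a) x -> A (insert ord_max (g x) x)) ->
  ((\sum_a volume (l a) (u a))%:E <= sigma A)%E.
Proof.
move=> mA luV lu dis luA.
pose F a : set (borel_rV R n.+1) := cylinder (obox (l a) (u a)) `&` G.
have mF a : measurable (F a) by exact: measurableI.
apply: (@le_trans _ _ (sigma (\bigcup_(a in [set: I]) F a))); last first.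
  apply: le_measure; rewrite ?inE//.
    by apply: fin_bigcup_measurable => //; exact: finite_finset.
  move=> s [a _ [luas [x Vx xs]]]; rewrite -xs; apply: (luA a).
  by move: luas; rewrite -xs /cylinder/= col'_insert.
have trivF : trivIset [set: I] F.
  apply/trivIsetP => a b _ _ ab; rewrite /F setIACA.
  rewrite (_ : cylinder _ `&` cylinder _ = set0) ?set0I//.
  by have := dis a b ab; rewrite -!subset0 => H s; exact: H.
rewrite (measure_fin_bigcup _ finite_finset trivF)//.
rewrite (_ : [set: I] = [set` index_enum I]); last first.
  by apply/seteqP; split => x //= _; rewrite mem_index_enum.
rewrite -fsbig_seq ?index_enum_uniq// -sumEFin.
by apply: lee_sum => a _; exact: sigma_obox_ge.
Qed.

End SurfaceBoxes.

(** * Lower bound for the upper limit *)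

Section FejerInequality.
Context d (T : measurableType d) (R : realType) (mu : {measure set T -> \bar R}).
Context (D : set T) (mD : measurable D) (finD : (mu D < +oo)%E).

Lemma bounded_Rintegrable (f : T -> R) (M : R) : measurable_fun D f ->
  (forall x, D x -> `|f x| <= M) -> mu.-integrable D (EFin \o f).
Proof.
move=> mf fM; apply: measurable_bounded_integrable => //.
exists M; split; first exact: num_real.
by move=> K MK x Dx; exact: le_trans (fM x Dx) (ltW MK).
Qed.

Lemma Rintegral_bigsum (I : Type) (s : seq I) (f : I -> T -> R) :
  (forall i, mu.-integrable D (EFin \o f i)) ->
  mu.-integrable D (EFin \o (fun x => \sum_(i <- s) f i x)) /\
  \int[mu]_(x in D) (\sum_(i <- s) f i x) = \sum_(i <- s) \int[mu]_(x in D) f i x.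
Proof.
move=> fint; elim: s => [|i s [ih1 ih2]].
  split; last first.
    by rewrite big_nil; under eq_Rintegral do rewrite big_nil; rewrite Rintegral_cst// mul0r.
  by apply: (@bounded_Rintegrable _ 0) => [|x _]; rewrite /= ?big_nil ?normr0//;
    under eq_fun do rewrite big_nil; exact: measurable_cst.
have E x : \sum_(j <- i :: s) f j x = f i x + \sum_(j <- s) f j x by rewrite big_cons.
split.
  rewrite (_ : _ \o _ = (EFin \o f i) \+ (EFin \o (fun x => (\sum_(j <- s) f j x)%R)))%E.
    exact: integrableD.
  by apply/funext => x; rewrite /= E EFinD.
rewrite big_cons -ih2 -RintegralD//.
by apply: eq_Rintegral => x _; rewrite E.
Qed.

Context (phi h : T -> R) (B : R).
Hypotheses (mphi : measurable_fun D phi) (mh : measurable_fun D h)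
  (phiB : forall x, D x -> 0 <= phi x <= B).

Let F (j : nat) : R := \int[mu]_(x in D) (cos (j%:R * h x) * phi x).

Let mcos (a : R) : measurable_fun D (fun x => cos (a * h x) * phi x).
Proof.
apply: measurable_funM => //; apply: measurableT_comp.
  by apply: continuous_measurable_fun; exact: continuous_cos.
by apply: measurable_funM => //; exact: measurable_cst.
Qed.

Let icos (a : R) : mu.-integrable D (EFin \o (fun x => cos (a * h x) * phi x)).
Proof.
apply: (@bounded_Rintegrable _ B) => // x Dx; have /andP[phi0 phiB'] := phiB Dx.
rewrite normrM (ger0_norm phi0) -[leRHS]mul1r; apply: ler_pM => //.
by rewrite ler_norml cos_geN1 cos_le1.
Qed.

Let Fcos (j k : nat) :
  \int[mu]_(x in D) (cos ((j%:R - k%:R) * h x) * phi x) = F `|j - k|%N.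
Proof.
rewrite /F; wlog jk : j k / (k <= j)%N.
  move=> H; have [kj|/ltnW jk] := leqP k j; first exact: H.
  by rewrite distnC -H//; apply: eq_Rintegral => x _; rewrite -opprB mulNr cosN.
by rewrite distnEl// natrB.
Qed.

Let sum_mono (u : nat -> R) m N : (forall j, 0 <= u j) -> (m <= N)%N ->
  \sum_(0 <= j < m) u j <= \sum_(0 <= j < N) u j.
Proof.
by move=> u0 mN; rewrite [leRHS](big_cat_nat (n := m))//= lerDl sumr_ge0.
Qed.

(** Each value of [|j - k|] is taken at most twice, once on each side of [k]. *)
Let sum_dist_le (u : nat -> R) N k : (forall j, 0 <= u j) -> (k < N)%N ->
  \sum_(j < N) u `|j - k|%N <= 2 * \sum_(j < N) u j.
Proof.
move=> u0 kN; rewrite -!(big_mkord xpredT (fun j => u `|j - k|%N)) -(big_mkord xpredT u).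
rewrite (big_cat_nat (n := k))//=; last exact: ltnW.
rewrite mulr_natl mulr2n; apply: lerD.
  rewrite big_nat_rev/= add0n.
  apply: (@le_trans _ _ (\sum_(0 <= i < k) u i.+1)).
    rewrite big_nat [leRHS]big_nat; apply: ler_sum => i /andP[_ ik].
    by rewrite le_eqVlt; apply/orP; left; apply/eqP; congr u; lia.
  apply: (@le_trans _ _ (\sum_(0 <= i < k.+1) u i)).
    by rewrite [leRHS]big_nat_recl// lerDr.
  exact: sum_mono.
have -> : \sum_(k <= j < N) u `|j - k|%N = \sum_(0 <= i < N - k) u i.
  rewrite -{1}[k]add0n big_addn; apply: eq_bigr => i _; congr u; lia.
by apply: sum_mono => //; exact: leq_subr.
Qed.

(** The double sum [K] equals [phi] times the sum of the squares of a cosine sum and a sine sum. It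
    is nonnegative on [D], and on [A] the cosine sum alone is at least [N * cos 1]. Integrated term
    by term, [K] gives the numbers [F |j - k|], and each of its [N] rows is at most twice the sum of
    the [|F j|]. *)
Lemma fejer_le (A : set T) (kappa : R) (N : nat) : measurable A -> A `<=` D ->
  0 <= kappa -> (0 < N)%N ->
  (forall x, A x -> `|h x| <= N%:R^-1 /\ kappa <= phi x) ->
  kappa * cos 1 ^+ 2 / 2 * (N%:R * fine (mu A)) <= \sum_(j < N) `|F j|.
Proof.
move=> mA AD kappa0 N0 hA.
have c1 : 0 < cos 1 :> R by exact: cos1_gt0.
have N0' : 0 < N%:R :> R by rewrite ltr0n.
pose K x := \sum_(k < N) \sum_(j < N) (cos ((j%:R - k%:R) * h x) * phi x).
have KE x : K x = ((\sum_(j < N) cos (j%:R * h x)) ^+ 2 +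
                   (\sum_(j < N) sin (j%:R * h x)) ^+ 2) * phi x.
  rewrite /K !expr2 !big_distrlr -big_split/= mulr_suml.
  apply: eq_bigr => k _; rewrite -big_split/= mulr_suml; apply: eq_bigr => j _.
  by rewrite mulrBl cosB; ring.
have K0 x : D x -> 0 <= K x.
  by move=> /phiB /andP[phi0 _]; rewrite KE mulr_ge0// addr_ge0// sqr_ge0.
have KA x : A x -> kappa * (N%:R * cos 1) ^+ 2 <= K x.
  move=> Ax; have [hN kphi] := hA _ Ax; have /andP[phi0 _] := phiB (AD _ Ax).
  rewrite KE mulrC; apply: ler_pM => //; first exact: sqr_ge0.
  rewrite -[leLHS]addr0; apply: lerD; last exact: sqr_ge0.
  have Nc0 : 0 <= N%:R * cos 1 :> R by rewrite mulr_ge0// ltW.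
  have H : N%:R * cos 1 <= \sum_(j < N) cos (j%:R * h x).
    rewrite mulr_natl -{1}(card_ord N) -sumr_const; apply: ler_sum => j _.
    rewrite -[leRHS]cos_norm; set t := `|_ * _|.
    have t1 : t <= 1.
      rewrite /t normrM normr_nat; apply: le_trans (ler_wpM2l (ler0n _ _) hN) _.
      by rewrite ler_pdivrMr// mul1r ler_nat ltnW.
    have pi2 := pi_ge2 R; have t0 : 0 <= t by exact: normr_ge0.
    have [->//|t1'] := eqVneq t 1.
    rewrite ltW// ltr_cos ?lt_neqAle ?t1'//; rewrite in_itv/=; apply/andP; split => //; lra.
  by apply: lerXn2r => //; rewrite nnegrE// (le_trans Nc0).
have [intk sumk] : mu.-integrable D (EFin \o K) /\
    \int[mu]_(x in D) K x = \sum_(k < N) \sum_(j < N) F `|j - k|%N.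
  have [H1 H2] := Rintegral_bigsum (index_enum 'I_N)
    (fun k => (Rintegral_bigsum (index_enum 'I_N) (fun j => icos (j%:R - k%:R))).1).
  split => //; rewrite H2; apply: eq_bigr => k _.
  rewrite (Rintegral_bigsum (index_enum 'I_N) (fun j => icos (j%:R - k%:R))).2.
  by apply: eq_bigr => j _; exact: Fcos.
have finA : (mu A < +oo)%E.
  by apply: le_lt_trans finD; apply: le_measure; rewrite ?inE.
have lower : kappa * (N%:R * cos 1) ^+ 2 * fine (mu A) <= \int[mu]_(x in D) K x.
  have mind : measurable_fun D (fun x => \1_A x : R) by exact: measurable_indic.
  have iind : mu.-integrable D (EFin \o (fun x => \1_A x : R)).
    by apply: (@bounded_Rintegrable _ 1) => // x _; rewrite indicE; case: (x \in A); rewrite ?normr1 ?normr0.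
  have -> : fine (mu A) = \int[mu]_(x in D) \1_A x.
    by rewrite /Rintegral integral_indic// setIidl.
  rewrite -RintegralZl//; apply: le_Rintegral => // [|x Dx].
    rewrite (_ : EFin \o _ = (fun x => (kappa * (N%:R * cos 1) ^+ 2)%:E * (EFin \o (\1_A : T -> R)) x))%E.
      exact: integrableZl.
    by apply/funext => x /=; rewrite EFinM.
  rewrite indicE; have [Ax|Ax] := pselect (A x).
    by rewrite mem_set// mulr1; exact: KA.
  by rewrite memNset// mulr0; exact: K0.
have upper : \int[mu]_(x in D) K x <= N%:R * (2 * \sum_(j < N) `|F j|).
  rewrite sumk (_ : N%:R * _ = \sum_(k < N) 2 * \sum_(j < N) `|F j|); last first.
    by rewrite sumr_const card_ord mulr_natl.
  apply: ler_sum => k _.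
  apply: le_trans (@sum_dist_le (fun j => `|F j|) N k _ (ltn_ord k)) => //.
  by apply: ler_sum => j _; exact: ler_norm.
rewrite -(ler_pM2l (_ : 0 < N%:R * 2)) ?mulr_gt0//.
rewrite -[leRHS]mulrA; apply: le_trans _ (le_trans lower upper).
by rewrite le_eqVlt; apply/orP; left; apply/eqP; field.
Qed.

End FejerInequality.

(** * Growth of sums of negative powers *)

Section Asymptotics.
Context {R : realType}.

Lemma powRD_gt0 (x r s : R) : 0 < x -> x `^ (r + s) = x `^ r * x `^ s.
Proof. by move=> x0; rewrite powRD// (gt_eqF x0) implybT. Qed.

(** Writing [j^-gam = j^(1/2 - gam) j^(-1/2)] and bounding the first factor by [N^(1/2 - gam)],
    legitimate since [gam <= 1/2], leaves the elementary sum of inverse square roots. *)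
Lemma sum_powRN_le (gam : R) N : 0 < gam <= 2^-1 -> (0 < N)%N ->
  \sum_(1 <= j < N) j%:R `^ (- gam) <= 2 * N%:R `^ (1 - gam).
Proof.
move=> /andP[gam0 gam2] N0.
have N0' : 0 < N%:R :> R by rewrite ltr0n.
(* With [a] and [b] the roots of [m] and [m + 1], the induction step is [2 a b + 1 <= 2 b ^ 2], that
   is [(a - b) ^ 2 >= 0]. *)
have sqrt_sum m : \sum_(1 <= j < m.+1) (Num.sqrt j%:R)^-1 <= 2 * Num.sqrt m%:R :> R.
  elim: m => [|m ih]; first by rewrite big_geq// mulr_ge0// sqrtr_ge0.
  rewrite big_nat_recr//=; apply: le_trans (lerD ih (lexx _)) _.
  set a := Num.sqrt _; set b := Num.sqrt _.
  have a0 : 0 <= a by exact: sqrtr_ge0.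
  have b0 : 0 < b by rewrite sqrtr_gt0 ltr0n.
  have : b ^+ 2 = a ^+ 2 + 1 by rewrite !sqr_sqrtr// natr1.
  rewrite -(ler_pM2l b0) mulrDr mulfV ?gt_eqF//.
  by have := sqr_ge0 (a - b); nra.
have {}sqrt_sum : \sum_(1 <= j < N) (Num.sqrt j%:R)^-1 <= 2 * Num.sqrt N%:R :> R.
  rewrite -(prednK N0); apply: le_trans (sqrt_sum _) _.
  by apply: ler_wpM2l => //; apply: ler_wsqrtr; rewrite ler_nat.
apply: (@le_trans _ _ (\sum_(1 <= j < N) N%:R `^ (2^-1 - gam) * (Num.sqrt j%:R)^-1)).
  rewrite big_nat [leRHS]big_nat; apply: ler_sum => j /andP[j1 jN].
  have j0 : 0 < j%:R :> R by rewrite ltr0n.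
  have -> : j%:R `^ (- gam) = j%:R `^ (2^-1 - gam) * j%:R `^ (- 2^-1) :> R.
    by rewrite -powRD_gt0//; rewrite (_ : 2^-1 - gam + - 2^-1 = - gam)//; ring.
  rewrite [_ `^ (- 2^-1)]powRN powR12_sqrt ?(ltW j0)//.
  apply: ler_wpM2r; first by rewrite invr_ge0 sqrtr_ge0.
  by apply: ge0_ler_powR; rewrite ?nnegrE ?subr_ge0 ?ler_nat ?(ltnW jN) ?ler0n//; lra.
rewrite [leLHS](_ : _ = N%:R `^ (2^-1 - gam) * \sum_(1 <= j < N) (Num.sqrt j%:R)^-1);
  last by rewrite mulr_sumr.
apply: le_trans (ler_wpM2l (powR_ge0 _ _) sqrt_sum) _.
rewrite mulrCA -powR12_sqrt// -powRD_gt0//.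
by rewrite (_ : 2^-1 - gam + 2^-1 = 1 - gam)//; field.
Qed.

(** Up to [J] the terms sum to a constant [C]; beyond [J] they contribute at most half of the lower
    bound [c X]. As [X] is at least the root of [N], it eventually exceeds [2 C / c], which is
    impossible. *)
Lemma growth_contradiction (u : nat -> R) (gam c : R) (p N0 : nat) :
  (forall j, 0 <= u j) -> 0 < gam <= 2^-1 -> 0 < c ->
  (forall N, (N0 <= N)%N ->
     c * (N%:R `^ (1 - gam) * ln N%:R ^+ p) <= \sum_(j < N) u j) ->
  ~ (forall eta, 0 < eta -> exists J : nat, forall j : nat, (J <= j)%N ->
     u j <= eta * (j%:R `^ (- gam) * ln j%:R ^+ p)).
Proof.
move=> u0 gam12 c0 low up; have /andP[gam0 gam2] := gam12.
have [J uJ] : exists J, forall j, (J <= j)%N ->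
    u j <= c / 4 * (j%:R `^ (- gam) * ln j%:R ^+ p) by apply: up; lra.
pose C := \sum_(0 <= j < J.+1) u j.
have C0 : 0 <= C by exact: sumr_ge0.
(* The bound by [expR 1] makes [ln N] at least 1, so that the logarithmic factor cannot shrink [X];
   the last bound gives [2 * C / c < X]. *)
pose N := maxn (maxn N0 J.+1) (maxn (Num.bound (expR 1 : R)) (Num.bound ((2 * C / c) ^+ 2))).+1.
have [N0N JN N3 NC] : [/\ N0 <= N, J.+1 <= N, Num.bound (expR 1 : R) <= N &
    Num.bound ((2 * C / c) ^+ 2) <= N]%N by rewrite /N; split; lia.
have Ngt0 : (0 < N)%N by apply: leq_trans JN.
have N1 : 1 <= N%:R :> R by rewrite ler1n.
have Npos : 0 < N%:R :> R by rewrite ltr0n.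
have ln1 : 1 <= ln N%:R :> R.
  rewrite -[leLHS]expRK ler_ln ?posrE ?expR_gt0//.
  by apply: le_trans (ltW (archi_boundP (expR_ge0 _))) _; rewrite ler_nat.
have lnp1 : 1 <= ln N%:R ^+ p :> R by exact: exprn_ege1.
set X := N%:R `^ (1 - gam) * ln N%:R ^+ p.
have X1 : Num.sqrt N%:R <= X.
  rewrite -[leLHS]mulr1 -powR12_sqrt; last exact: ltW.
  by apply: ler_pM => //; apply: ler_powR => //; lra.
have X2 : 2 * C / c < X.
  apply: lt_le_trans X1; rewrite -[ltLHS]ger0_norm; last first.
    by rewrite divr_ge0 ?mulr_ge0// ltW.
  rewrite -sqrtr_sqr ltr_sqrt//; apply: lt_le_trans (archi_boundP (sqr_ge0 _)) _.
  by rewrite ler_nat.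
have upper : \sum_(j < N) u j <= C + c / 4 * (2 * X).
  rewrite -(big_mkord xpredT u) (big_cat_nat (n := J.+1))//= lerD2l.
  apply: (@le_trans _ _ (c / 4 * (ln N%:R ^+ p * \sum_(1 <= j < N) j%:R `^ (- gam)))).
    rewrite mulr_sumr [leRHS]mulr_sumr [leRHS](big_cat_nat (n := J.+1))//=.
    rewrite -[leLHS]add0r; apply: lerD.
      apply: sumr_ge0 => j _; apply: mulr_ge0; first lra.
      by rewrite mulr_ge0 ?powR_ge0// (le_trans ler01).
    rewrite big_nat [leRHS]big_nat; apply: ler_sum => j /andP[Jj jN].
    apply: le_trans (uJ j _) _; first exact: ltnW.
    apply: ler_wpM2l; first lra.
    rewrite mulrC; apply: ler_wpM2r; first exact: powR_ge0.
    have j0 : (0 < j)%N by apply: leq_trans Jj.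
    apply: lerXn2r; rewrite ?nnegrE ?ln_ge0 ?ler1n//.
    by rewrite ler_ln ?posrE ?ltr0n// ler_nat ltnW.
  apply: ler_wpM2l; first lra.
  rewrite [leLHS]mulrC /X [leRHS]mulrA; apply: ler_wpM2r; first by rewrite (le_trans ler01).
  exact: sum_powRN_le.
have := le_trans (low _ N0N) upper; rewrite -/X.
move: X2; rewrite ltr_pdivrMr//; lra.
Qed.

End Asymptotics.

(** * From small sublevel sets to the upper limit *)

Section LimsupLowerBound.
Context {R : realType} {n : nat}.

Lemma limsup_sphere_le0 m (q : 'rV[R]_m -> R) : ~ (0 < limsup_sphere q)%E ->
  forall eta : R, 0 < eta -> exists M : R, forall lam, M < enorm lam -> q lam <= eta.
Proof.
move=> /negP; rewrite -leNgt => q0 eta eta0.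
have /ereal_inf_lt[_ [A [M [_ AM]] <-] supA] : (limsup_sphere q < eta%:E)%E.
  by apply: le_lt_trans q0 _; rewrite lte_fin.
exists M => lam /AM Alam; rewrite -lee_fin; apply: le_trans (ltW supA).
apply: (@le_trans _ _ (ereal_sup [set (q lam')%:E | lam' in [set v | enorm v = enorm lam]])).
  by apply: ereal_sup_ubound; exists lam.
by apply: ereal_sup_ubound; exists (enorm lam).
Qed.

Lemma dotZl m (k : R) (u v : 'rV[R]_m) : dot (k *: u) v = k * dot u v.
Proof. by rewrite /dot mulr_sumr; apply: eq_bigr => i _; rewrite mxE mulrA. Qed.

Lemma enormZ m (k : R) (u : 'rV[R]_m) : 0 <= k -> enorm (k *: u) = k * enorm u.
Proof.
move=> k0; rewrite /enorm (_ : dot _ _ = k ^+ 2 * dot u u); last first.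
  by rewrite /dot mulr_sumr; apply: eq_bigr => i _; rewrite !mxE; ring.
by rewrite sqrtrM ?sqr_ge0// sqrtr_sqr ger0_norm.
Qed.

Lemma dot_continuous m (u : 'rV[R]_m) : continuous (dot u).
Proof.
move=> x; rewrite /dot; elim: (index_enum _) => [|i s ih].
  by under eq_fun do rewrite big_nil; exact: cst_continuous.
under eq_fun do rewrite big_cons.
apply: continuousD ih; apply: continuousM; first exact: cst_continuous.
exact: coord_continuous.
Qed.

Context {S : set 'rV[R]_n.+1} {sigma : {measure set (borel_rV R n.+1) -> \bar R}}.
Context {D : set (borel_rV R n.+1)} {phi : 'rV[R]_n.+1 -> R} {B : R}.
Hypotheses (mD : measurable D) (DS : D `<=` S) (finD : (sigma D < +oo)%E)
  (cphi : continuous phi) (phi_out : forall s, S s -> ~ D s -> phi s = 0)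
  (phiB : forall s, 0 <= phi s <= B).

Local Notation normc := ComplexField.Normc.normc.

(** Replaces [S], whose measure may be infinite, by the finite-measure set [D], on which bounded
    measurable functions are integrable. *)
Let RintSD (f : 'rV[R]_n.+1 -> R) :
  \int[sigma]_(s in S) (f s * phi s) = \int[sigma]_(s in D) (f s * phi s).
Proof.
rewrite Rintegral_mkcond [RHS]Rintegral_mkcond; apply: eq_Rintegral => s _.
rewrite !patchE; case: (asboolP (D s)) => [Ds|Ds].
  by rewrite !mem_set//; exact: DS.
rewrite [s \in D]memNset//; have [Ss|Ss] := pselect (S s).
  by rewrite mem_set// phi_out// mulr0.
by rewrite memNset.
Qed.

(** The shift of the phase by [c0] only rotates the transform: by the addition formula the integral
    is a combination of its real and imaginary parts with coefficients of modulus at most 1, whence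
    the factor 2. *)
Lemma Rintegral_cos_le_fourier (l1 : 'rV[R]_n.+1) (c0 : R) (j : nat) :
  `|\int[sigma]_(s in D) (cos (j%:R * (dot l1 s - c0)) * phi s)| <=
    2 * normc (surface_fourier S sigma phi (j%:R *: l1)).
Proof.
pose t (s : 'rV[R]_n.+1) := - dot (j%:R *: l1) s.
pose Tr := \int[sigma]_(s in D) (cos (t s) * phi s).
pose Ti := \int[sigma]_(s in D) (sin (t s) * phi s).
have -> : surface_fourier S sigma phi (j%:R *: l1) = (Tr +i* Ti)%C.
  rewrite /surface_fourier /cintegral /Tr /Ti -!RintSD; congr (_ +i* _)%C;
    by apply: eq_Rintegral => s _; rewrite /= ?mulr0 ?subr0 ?add0r.
have mcyc (f : R -> R) : continuous f -> measurable_fun D (fun s => f (t s) * phi s).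
  move=> cf; apply: measurable_funM; last first.
    by apply: measurable_funS (continuous_measurable_rV cphi).
  apply: measurable_funS (continuous_measurable_rV _) => // s.
  apply: (@continuous_comp _ _ _ t f); last exact: cf.
  by apply: continuousN; exact: dot_continuous.
have icyc (f : R -> R) : continuous f -> (forall x, `|f x| <= 1) ->
    sigma.-integrable D (EFin \o (fun s => f (t s) * phi s)).
  move=> cf f1; apply: (bounded_Rintegrable mD finD (M := B) (mcyc _ cf)) => s _.
  have /andP[phi0 phiB'] := phiB s.
  by rewrite normrM (ger0_norm phi0) -[leRHS]mul1r; apply: ler_pM.
have icos : sigma.-integrable D (EFin \o (fun s => cos (t s) * phi s)).
  apply: icyc; first exact: continuous_cos.
  by move=> x; rewrite ler_norml cos_geN1 cos_le1.
have isin : sigma.-integrable D (EFin \o (fun s => sin (t s) * phi s)).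
  apply: icyc; first exact: continuous_sin.
  by move=> x; rewrite ler_norml sin_geN1 sin_le1.
have -> : \int[sigma]_(s in D) (cos (j%:R * (dot l1 s - c0)) * phi s) =
    cos (j%:R * c0) * Tr + - sin (j%:R * c0) * Ti.
  rewrite -!RintegralZl// -RintegralD//; last 2 first.
  - exact: integrableZl icos.
  - exact: integrableZl isin.
  apply: eq_Rintegral => s _.
  rewrite (_ : j%:R * (dot l1 s - c0) = - (t s + j%:R * c0)); last first.
    by rewrite /t dotZl; ring.
  by rewrite cosN cosD; ring.
rewrite /normc; set r := Num.sqrt _.
have Trr : `|Tr| <= r by rewrite -sqrtr_sqr ler_wsqrtr// lerDl sqr_ge0.
have Tir : `|Ti| <= r by rewrite -sqrtr_sqr ler_wsqrtr// lerDr sqr_ge0.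
apply: le_trans (ler_normD _ _) _; rewrite [leRHS]mulr_natl mulr2n !normrM normrN.
apply: lerD; rewrite -[leRHS]mul1r; apply: ler_pM => //.
  by rewrite ler_norml cos_geN1 cos_le1.
by rewrite ler_norml sin_geN1 sin_le1.
Qed.

Lemma limsup_sphere_gt0 (l1 : 'rV[R]_n.+1) (c0 gam c kappa : R) (p N0 : nat) :
  1 <= enorm l1 -> 0 < gam <= 2^-1 -> 0 < c -> 0 < kappa ->
  (forall N, (N0 <= N)%N -> exists A : set (borel_rV R n.+1),
    [/\ measurable A, A `<=` D,
      forall s, A s -> `|dot l1 s - c0| <= N%:R^-1 /\ kappa <= phi s &
      ((c * (N%:R `^ (- gam) * ln N%:R ^+ p))%:E <= sigma A)%E]) ->
  (0 < limsup_sphere (fun lambda => normc (surface_fourier S sigma phi lambda) /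
    (enorm lambda `^ (- gam) * ln (enorm lambda) ^+ p))%R)%E.
Proof.
move=> l1_1 gam12 c_gt0 kappa0 low; apply: contrapT => /limsup_sphere_le0 up.
pose u (j : nat) := `|\int[sigma]_(s in D) (cos (j%:R * (dot l1 s - c0)) * phi s)|.
have c1 : 0 < cos 1 :> R by exact: cos1_gt0.
have l1_0 : 0 < enorm l1 by exact: lt_le_trans l1_1.
apply: (@growth_contradiction _ u gam (kappa * cos 1 ^+ 2 / 2 * c) p N0.+1) => //.
- by move=> j; exact: normr_ge0.
- by rewrite !mulr_gt0// exprn_gt0.
- move=> N NN; have [A [mA AD hA sA]] := low _ (ltnW NN).
  have N0' : (0 < N)%N by apply: leq_trans NN.
  have fej := @fejer_le _ _ _ sigma D mD finD phi (fun s => dot l1 s - c0) B _ _ _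
    A kappa N mA AD (ltW kappa0) N0' hA.
  apply: le_trans (fej _ _ _) => //.
  + rewrite -mulrA; apply: ler_wpM2l.
      by rewrite !mulr_ge0// ?sqr_ge0// ltW.
    have finA : (sigma A < +oo)%E.
      by apply: le_lt_trans finD; apply: le_measure; rewrite ?inE.
    have : c * (N%:R `^ (- gam) * ln N%:R ^+ p) <= fine (sigma A).
      by rewrite -lee_fin fineK// ge0_fin_numE.
    move=> /(ler_wpM2l (ler0n R N)); apply: le_trans.
    rewrite powRD_gt0 ?ltr0n// powRr1// le_eqVlt; apply/orP; left; apply/eqP; ring.
  + exact: measurable_funS (continuous_measurable_rV cphi).
  + apply: measurable_funS (continuous_measurable_rV _) => // s.
    by apply: continuousB; [exact: dot_continuous|exact: cst_continuous].
move=> eta eta0.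
(* The first 2 comes from [Rintegral_cos_le_fourier]; [2 ^+ p] comes from
   [ln (j * enorm l1) <= 2 * ln j], valid once [j] exceeds [enorm l1]. *)
have two_p : 0 < 2 * 2 ^+ p :> R by rewrite mulr_gt0// exprn_gt0.
have [M uM] := up (eta / (2 * 2 ^+ p)) (divr_gt0 eta0 two_p).
exists (maxn (Num.bound (Num.max M 0)) (Num.bound (enorm l1))).+2 => j.
rewrite -!maxnSS geq_max => /andP[jb1 jb2].
have jM : M < j%:R.
  apply: (@le_lt_trans _ _ (Num.max M 0)); first by rewrite le_max lexx.
  apply: lt_trans (archi_boundP _) _; first by rewrite le_max lexx orbT.
  by rewrite ltr_nat ltnW.
have jl : enorm l1 <= j%:R.
  by apply: le_trans (ltW (archi_boundP (ltW l1_0))) _; rewrite ler_nat ltnW// ltnW.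
have j1 : 1 < j%:R :> R by rewrite ltr1n; apply: leq_trans jb1.
have j0 : 0 < j%:R :> R by exact: lt_trans j1.
have jlE : enorm (j%:R *: l1) = j%:R * enorm l1 by rewrite enormZ// ltW.
have jjl : j%:R <= j%:R * enorm l1 by rewrite ler_peMr// ltW.
have jl1 : 1 < j%:R * enorm l1 by exact: lt_le_trans jjl.
have jl0 : 0 < j%:R * enorm l1 by exact: lt_trans jl1.
have := uM (j%:R *: l1); rewrite jlE => /(_ (lt_le_trans jM jjl)).
have ln0 : 0 < ln (j%:R * enorm l1) by exact: ln_gt0.
rewrite ler_pdivrMr; last by rewrite mulr_gt0 ?powR_gt0// exprn_gt0.
move=> TM; apply: le_trans (Rintegral_cos_le_fourier l1 c0 j) _.
apply: le_trans (ler_wpM2l _ TM) _ => //.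
have den : (j%:R * enorm l1) `^ (- gam) * ln (j%:R * enorm l1) ^+ p <=
    j%:R `^ (- gam) * (2 * ln j%:R) ^+ p.
  apply: ler_pM; [exact: powR_ge0|by rewrite exprn_ge0// ltW| |].
    rewrite !powRN lef_pV2 ?posrE ?powR_gt0//.
    by apply: ge0_ler_powR; rewrite ?nnegrE//; [case/andP: gam12 => /ltW|exact: ltW..].
  apply: lerXn2r; rewrite ?nnegrE; first exact: ltW.
    by rewrite mulr_ge0// ln_ge0// ltW.
  rewrite lnM ?posrE// mulr_natl mulr2n lerD2l.
  by rewrite ler_ln ?posrE.
rewrite mulrA; apply: le_trans (ler_wpM2l _ den) _.
  by rewrite mulr_ge0// divr_ge0// ltW.
rewrite exprMn le_eqVlt; apply/orP; left; apply/eqP; field.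
by rewrite expf_neq0.
Qed.

End LimsupLowerBound.

(** * Newton polyhedron *)

Section NewtonWeights.
Context {R : realType}.

Lemma finite_pos_lower_bound (I : finType) (f : I -> R) :
  exists2 om : R, 0 < om & forall i, 0 < f i -> om <= f i.
Proof.
suff [om om0 omf] : exists2 om : R, 0 < om & forall i, i \in enum I -> 0 < f i -> om <= f i.
  by exists om => // i; apply: omf; rewrite mem_enum.
elim: (enum I) => [|i s [om om0 omf]]; first by exists 1.
exists (if 0 < f i then Num.min om (f i) else om).
  by case: ifP => // fi0; rewrite lt_min om0.
move=> j; rewrite in_cons => /predU1P[->|js] fj0.
  by rewrite fj0 ge_min lexx orbT.
by case: ifP => _; rewrite ?ge_min omf.
Qed.

Context {n : nat}.
Implicit Types (x v w : 'rV[R]_n).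

Lemma dotDl u v w : dot (u + v) w = dot u w + dot v w.
Proof. by rewrite /dot -big_split; apply: eq_bigr => i _; rewrite mxE mulrDl. Qed.

Lemma dotDr u v w : dot w (u + v) = dot w u + dot w v.
Proof. by rewrite /dot -big_split; apply: eq_bigr => i _; rewrite mxE mulrDr. Qed.

Lemma dotZr (k : R) u w : dot w (k *: u) = k * dot w u.
Proof. by rewrite /dot mulr_sumr; apply: eq_bigr => i _; rewrite mxE mulrCA. Qed.

Lemma dot_delta w j : dot w (delta_mx 0 j) = w 0 j.
Proof.
rewrite /dot (bigD1 j)//= big1 ?addr0; first by rewrite mxE !eqxx mulr1.
by move=> i ij; rewrite mxE (negbTE ij) andbF mulr0.
Qed.

Lemma dot_const w (t : R) : dot w (const_mx t) = t * \sum_i w 0 i.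
Proof. by rewrite /dot mulr_sumr; apply: eq_bigr => i _; rewrite mxE mulrC. Qed.

Lemma newton_polyhedron_supp (f : 'rV[R]_n -> R) al : taylor_coef f al != 0 ->
  newton_polyhedron f (mpoint al).
Proof.
move=> al0 C [_ subAC]; apply: subAC; exists al => //= i.
by rewrite mxE.
Qed.

(** Orthants are stable under adding a unit vector, and the translate of a convex set containing
    them all is again such a set. This makes supporting covectors nonnegative. *)
Lemma newton_polyhedronD_delta (f : 'rV[R]_n -> R) x j :
  newton_polyhedron f x -> newton_polyhedron f (x + delta_mx 0 j).
Proof.
move=> Nx C [cC subAC]; apply: (Nx [set y | C (y + delta_mx 0 j)]); split.
  move=> a b t /set_mem/= Ca /set_mem/= Cb; apply/mem_set => /=.
  have := cC (a + delta_mx 0 j) (b + delta_mx 0 j) t (mem_set Ca) (mem_set Cb).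
  move=> /set_mem; congr C.
  rewrite -[LHS]/(t%:inum *: (a + delta_mx 0 j) + (1 - t%:inum) *: (b + delta_mx 0 j)).
  rewrite -[RHS]/(t%:inum *: a + (1 - t%:inum) *: b + delta_mx 0 j).
  by rewrite !scalerDr addrACA -scalerDl [t%:inum + _]addrC subrK scale1r.
move=> y [al al0 yal]; apply: subAC; exists al => //= i.
by rewrite mxE (le_trans (yal i))// lerDl mxE; case: (_ && _).
Qed.

(** The rows are taken from the kernel of the matrix formed by a basis of [L] and the all-ones
    vector, of rank at most [\dim L + 1]. Perturbing a weight along them changes neither its pairing
    with the directions of the face nor its coordinate sum. *)
Lemma orthogonal_rows (L : {vspace 'rV[R]_n}) p : (p + (\dim L).+1 <= n)%N ->
  exists U : 'M[R]_(p, n), row_free U /\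
    forall m : 'rV_p, (forall v, v \in L -> dot (m *m U) v = 0) /\
      dot (m *m U) (const_mx 1) = 0.
Proof.
move=> pn.
pose M : 'M[R]_(\dim L + 1, n) := col_mx (\matrix_i (vbasis L)`_i) (const_mx 1).
pose K := kermx M^T.
have pK : (p <= \rank K)%N.
  rewrite mxrank_ker mxrank_tr; have := rank_leq_row M.
  by lia.
pose U : 'M[R]_(p, n) := (pid_mx p : 'M[R]_(p, mxrank K)) *m row_base K.
exists U; split.
  rewrite /row_free /U mxrankMfree ?row_base_free// rank_pid_mx//.
have UM (m : 'rV_p) : m *m U *m M^T = 0.
  apply/sub_kermxP; rewrite /U mulmxA; apply: submx_trans (submxMl _ _) _.
  by rewrite eq_row_base.
have dotM (m : 'rV_p) i : dot (m *m U) (row i M) = 0.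
  have := congr1 (fun A : 'M[R]_(1, \dim L + 1) => A 0 i) (UM m).
  rewrite [RHS]mxE => <-; rewrite [RHS]mxE /dot; apply: eq_bigr => j _.
  by congr (_ * _); rewrite !mxE.
move=> m; split=> [v vL|].
  rewrite (coord_vbasis vL) /dot.
  under eq_bigr do rewrite summxE mulr_sumr.
  rewrite exchange_big big1// => i _.
  have := dotM m (lshift 1 i); rewrite rowKu rowK => H.
  transitivity (coord (vbasis L) i v * dot (m *m U) (vbasis L)`_i).
    rewrite /dot mulr_sumr; apply: eq_bigr => j _. 
    have -> : (coord (vbasis L) i v *: (vbasis L)`_i) 0 j =
      coord (vbasis L) i v * (vbasis L)`_i 0 j by rewrite mxE.
    by rewrite mulrCA.
  by rewrite H mulr0.
have := dotM m (rshift (\dim L) 0); rewrite rowKd => <-; congr dot.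
by apply/rowP => j; rewrite !mxE.
Qed.


(** If [L] is the whole space the natural subtraction gives 0 rows. *)
Lemma orthogonal_rows_codim (L : {vspace 'rV[R]_n}) :
  exists U : 'M[R]_(n - \dim L - 1, n), row_free U /\
    forall m : 'rV_(n - \dim L - 1), (forall v, v \in L -> dot (m *m U) v = 0) /\
      dot (m *m U) (const_mx 1) = 0.
Proof.
have [Ln|nL] := ltnP (\dim L) n; first by apply: orthogonal_rows; lia.
have p0 : (n - \dim L - 1 = 0)%N by lia.
exists 0; rewrite p0; split => [|m].
  by rewrite /row_free mxrank0.
by rewrite mulmx0 /dot; split => [v _|]; apply: big1 => i _; rewrite mxE mul0r.
Qed.

(** On exponents of [F] the perturbation [v = m *m U] pairs to 0, so the value is exactly [tau * c].
    Off [F] discreteness of the exponents leaves a gap, [dot w0 al >= c + eta], and a perturbation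
    with [|v_j| <= kap * tau * w0_j] cannot consume it. *)
Lemma newton_weights (f : 'rV[R]_n -> R) k : critical_face_dim f k ->
  0 < newton_distance f ->
  exists (w0 : 'rV[R]_n) (U : 'M[R]_(n - k - 1, n)) (c del : R),
    [/\ 0 < c, 0 < del, row_free U & forall (tau : R) (m : 'rV_(n - k - 1)),
      0 <= tau -> (forall i, `|m 0 i| <= del * tau) ->
      [/\ forall i, 0 <= (tau *: w0 + m *m U) 0 i,
          \sum_i (tau *: w0 + m *m U) 0 i = tau * c / newton_distance f &
          forall al, taylor_coef f al != 0 ->
            tau * c <= dot (tau *: w0 + m *m U) (mpoint al)]].
Proof.
set D := newton_distance f; set N := newton_polyhedron f.
move=> [F [[w0 [c [w0neq Nc FE _]]] [FD _] [x0 [L [dimL affF]]]]] D0.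
subst k; have [U [Ufree Uorth]] := orthogonal_rows_codim L.
have FN x : F x <-> N x /\ dot w0 x = c by rewrite FE.
have [ND w0D] := (FN _).1 FD.
have FL x : F x -> x - const_mx D \in L.
  have aff y : F y -> exists2 v, v \in L & y = x0 + v.
    move=> Fy; have : affine_hull F y.
      exists 1%N, (fun=> y), (fun=> 1).
      by split=> //; rewrite big_ord1// scale1r.
    by rewrite affF => -[v vL <-]; exists v.
  move=> /aff[v vL ->]; have [v' v'L ->] := aff _ FD.
  by rewrite opprD addrACA subrr add0r rpredB.
have w0_ge0 j : 0 <= w0 0 j.
  have := Nc _ (newton_polyhedronD_delta j ND).
  by rewrite dotDr dot_delta w0D lerDl.
(* A coordinate of zero weight is a direction in which [F] is unbounded. Its unit vector lies in
   [L], so [v] vanishes there and the relative bound [vle] on [v] is possible. *)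
have L_delta j : w0 0 j = 0 -> (delta_mx 0 j : 'rV[R]_n) \in L.
  move=> w0j; have : F (const_mx D + delta_mx 0 j).
    apply/FN; split; first exact: newton_polyhedronD_delta.
    by rewrite dotDr dot_delta w0D w0j addr0.
  by move=> /FL; rewrite addrAC subrr add0r.
have sum_w0 : \sum_i w0 0 i = c / D by rewrite -w0D dot_const mulrAC mulfV ?gt_eqF// mul1r.
have c0 : 0 < c.
  have : c != 0.
    apply: contra w0neq => /eqP c0; move: sum_w0; rewrite c0 mul0r => /eqP.
    rewrite psumr_eq0 => [/allP H|i _]; last exact: w0_ge0.
    by apply/eqP/rowP => i; rewrite mxE; have := H i (mem_index_enum _) => /eqP.
  rewrite lt_neqAle eq_sym => ->/=; rewrite -w0D dot_const.
  by apply: mulr_ge0; [exact: ltW|exact: sumr_ge0].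
have [om om0 omw] := finite_pos_lower_bound (fun j => w0 0 j).
(* Among exponents with [dot w0 al < c + 1], the coordinates of positive weight are at most
   [(c + 1) / om]. With the others replaced by 0, which does not change the pairing, finitely many
   values remain, so those above [c] stay away from it. *)
pose M := Num.bound ((c + 1) / om).
have [eta0 eta00 eta0P] := finite_pos_lower_bound
  (fun be : {ffun 'I_n -> 'I_M.+1} => \sum_j w0 0 j * (be j)%:R - c).
pose eta := Num.min 1 eta0.
have eta_gt0 : 0 < eta by rewrite lt_min ltr01.
have gap al : taylor_coef f al != 0 -> F (mpoint al) \/ c + eta <= dot w0 (mpoint al).
  move=> /newton_polyhedron_supp Nal; have := Nc _ Nal.
  rewrite le_eqVlt => /predU1P[cE|cl]; first by left; apply/FN.
  right; have [big|small] := leP (c + 1) (dot w0 (mpoint al)).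
    by apply: le_trans big; rewrite lerD2l ge_min lexx.
  pose be : {ffun 'I_n -> 'I_M.+1} := [ffun j => inord (if 0 < w0 0 j then al j else 0)].
  have beE : dot w0 (mpoint al) = \sum_j w0 0 j * (be j)%:R.
    rewrite /dot; apply: eq_bigr => j _; rewrite mxE ffunE.
    have [w0j|w0j] := ltP 0 (w0 0 j); last first.
      by have -> : w0 0 j = 0; [apply/eqP; rewrite eq_le w0j w0_ge0|rewrite !mul0r].
    rewrite inordK// ltnS -(ler_nat R).
    have : w0 0 j * (al j)%:R <= c + 1.
      apply: le_trans (ltW small); rewrite /dot (bigD1 j)//= mxE lerDl.
      by apply: sumr_ge0 => i _; rewrite mxE mulr_ge0.
    rewrite mulrC -ler_pdivlMr// => H; apply: le_trans H _.
    apply: le_trans (_ : (c + 1) / om <= _).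
      by apply: ler_wpM2l; [lra|rewrite lef_pV2 ?posrE// omw].
    by apply/ltW/archi_boundP; rewrite divr_ge0//; lra.
  have := eta0P be; rewrite -beE subr_gt0 => /(_ cl) H.
  rewrite addrC -lerBrDr; apply: le_trans H; by rewrite ge_min lexx orbT.
(* Solves [(1 - kap) * (c + eta) = c]. *)
pose kap := eta / (c + eta).
have kap0 : 0 < kap by rewrite divr_gt0// addr_gt0.
have kap1 : kap <= 1 by rewrite ler_pdivrMr ?addr_gt0// mul1r lerDr ltW.
pose T := 1 + \sum_i \sum_j `|U i j|.
have T0 : 0 < T by rewrite ltr_pwDl// sumr_ge0// => i _; exact: sumr_ge0.
exists w0, U, c, (kap * om / T); split=> // [|tau m tau0 mtau].
  by rewrite divr_gt0// mulr_gt0.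
have [] := Uorth m; set v := m *m U => vL v1.
have vle j : `|v 0 j| <= kap * tau * w0 0 j.
  have [w0j|w0j] := ltP 0 (w0 0 j); last first.
    have w00 : w0 0 j = 0 by apply/eqP; rewrite eq_le w0j w0_ge0.
    by rewrite -(dot_delta v j) vL ?L_delta// w00 mulr0 normr0.
  apply: le_trans (_ : kap * tau * om <= _); last first.
    by apply: ler_wpM2l; [rewrite mulr_ge0// ltW|exact: omw].
  rewrite mxE; apply: le_trans (ler_norm_sum _ _ _) _.
  apply: (@le_trans _ _ (\sum_i (kap * om / T * tau) * `|U i j|)).
    by apply: ler_sum => i _; rewrite normrM; apply: ler_wpM2r.
  rewrite -mulr_sumr.
  have UT : \sum_i `|U i j| <= T.
    rewrite -[leLHS]add0r; apply: lerD => //; apply: ler_sum => i _.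
    by rewrite (bigD1 j)//= lerDl sumr_ge0.
  have H : 0 <= kap * om / T * tau by apply: mulr_ge0 => //; rewrite ltW// divr_gt0// mulr_gt0.
  apply: le_trans (ler_wpM2l H UT) _.
  by rewrite le_eqVlt; apply/orP; left; apply/eqP; field; rewrite gt_eqF.
split.
- move=> j; rewrite mxE [X in X + _]mxE.
  have := vle j; rewrite ler_norml => /andP[+ _].
  have := ler_wpM2r (mulr_ge0 tau0 (w0_ge0 j)) kap1; lra.
- rewrite (_ : \sum_i _ = dot (tau *: w0 + v) (const_mx 1)); last by rewrite dot_const mul1r.
  by rewrite dotDl v1 addr0 dotZl dot_const mul1r sum_w0 mulrA.
move=> al alf; rewrite dotDl dotZl.
have [Fal|cal] := gap _ alf.
  have := vL _ (FL _ Fal); rewrite dotDr -scaleN1r dotZr.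
  rewrite (_ : const_mx D = D *: const_mx 1); last first.
    by apply/rowP => i; rewrite !mxE mulr1.
  rewrite dotZr v1 !mulr0 addr0 => ->; rewrite addr0.
  by have [_ ->] := (FN _).1 Fal.
have val : `|dot v (mpoint al)| <= kap * tau * dot w0 (mpoint al).
  rewrite /dot; apply: le_trans (ler_norm_sum _ _ _) _; rewrite mulr_sumr.
  apply: ler_sum => j _; rewrite [mpoint al 0 j]mxE normrM normr_nat mulrA.
  by apply: ler_wpM2r.
have : - (kap * tau * dot w0 (mpoint al)) <= dot v (mpoint al).
  by move: val; rewrite ler_norml => /andP[].
have cE : (1 - kap) * (c + eta) = c.
  by rewrite /kap; field; rewrite gt_eqF// addr_gt0.
have : tau * c <= tau * ((1 - kap) * dot w0 (mpoint al)).
  by apply: ler_wpM2l => //; rewrite -[leLHS]cE; apply: ler_wpM2l => //; rewrite subr_ge0.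
lra.
Qed.

End NewtonWeights.

(** * Boxes given by the weights of the Newton polyhedron *)

Section SmallBoxes.
Context {R : realType} {n : nat}.

(* Inside [Q], the sublevel set [|h| <= 1/N] contains disjoint boxes of total
   volume at least [c N^-gam (ln N)^p]. *)
Definition small_boxes (h : 'rV[R]_n -> R) (Q : set 'rV[R]_n) (gam : R) (p : nat) :=
  exists (c : R) (N0 : nat), 0 < c /\ forall N, (N0 <= N)%N ->
    exists (I : finType) (l u : I -> 'rV[R]_n),
      [/\ forall a i, l a 0 i <= u a 0 i,
          forall a b, a != b -> obox (l a) (u a) `&` obox (l b) (u b) = set0,
          forall a x, obox (l a) (u a) x -> Q x /\ `|h x| <= N%:R^-1 &
          c * (N%:R `^ (- gam) * ln N%:R ^+ p) <= \sum_a volume (l a) (u a)].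

(** On the box a monomial is at most [r ^+ mdegree al * expR (- dot w (mpoint al))], so every term
    present in the series gains the factor [expR (- s)] over the terms summed in [B]. Nonnegative
    weights keep the box inside the cube of convergence. *)
Lemma expands_weight_le (f : 'rV[R]_n -> R) c r B (w x : 'rV[R]_n) (s : R) :
  expands f 0 c id r B -> (forall al, c al != 0 -> s <= dot w (mpoint al)) ->
  (forall i, 0 <= w 0 i) -> (forall i, 0 < x 0 i < r * expR (- w 0 i)) ->
  `|f x| <= B * expR (- s).
Proof.
move=> [r0 cB fc] ws w0 xw.
have xr : `|x - 0| < r.
  rewrite subr0; apply: norm_lt_coord => // i; have /andP[x0 xi] := xw i.
  rewrite gtr0_norm//; apply: lt_le_trans xi _.
  by rewrite ler_piMr ?expR_le1 ?oppr_le0// ltW.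
apply: lim_norm_le (fc _ xr) _ => N; rewrite subr0.
apply: le_trans (ler_norm_csum _ _) _.
apply: (@le_trans _ _ (csum N (fun al => expR (- s) * (`|c al| * r ^+ mdegree al)))).
  apply: le_csum => al; rewrite normrM.
  have [->|cal] := eqVneq (c al) 0; first by rewrite normr0 !mul0r mulr0.
  rewrite mulrCA; apply: ler_wpM2l => //.
  have xal : `|monomial al x| <= r ^+ mdegree al * expR (- dot w (mpoint al)).
    rewrite /monomial normr_prod.
    have -> : r ^+ mdegree al * expR (- dot w (mpoint al)) =
        \prod_i (r * expR (- w 0 i)) ^+ al i.
      rewrite /mdegree -prodrXr /dot -sumrN expR_sum -big_split/=.
      by apply: eq_bigr => i _; rewrite exprMn mxE -mulNr expRM_natr.
    apply: ler_prod => i _; rewrite normr_ge0 normrX/=.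
    have /andP[x0 xi] := xw i.
    by rewrite lerXn2r// ?nnegrE// ?(gtr0_norm x0) ?(ltW xi)// mulr_ge0 ?expR_ge0// ltW.
  apply: le_trans xal _; rewrite mulrC; apply: ler_wpM2r.
    by rewrite exprn_ge0// ltW.
  by rewrite ler_expR lerN2; exact: ws.
by rewrite csumZ mulrC; apply: ler_wpM2r; [exact: expR_ge0|exact: cB].
Qed.

(** The weights [tau *: w0 + m *m U], with [m] on a grid of step [Lam] in the cube of side
    [del * tau], index the boxes. There are about [(ln N) ^ p] of them, pairwise disjoint and all of
    the same volume. *)
Lemma newton_small_boxes (f : 'rV[R]_n -> R) c r B k (rho : R) :
  expands f 0 c id r B -> critical_face_dim f k -> 0 < newton_distance f ->
  0 < rho -> small_boxes f [set x | `|x| < rho] (newton_distance f)^-1 (n - k - 1).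
Proof.
move=> fE0 fk d0 rho0; set d := newton_distance f in d0 *; set p := (n - k - 1)%N.
have [r0 _ _] := fE0.
have r1_0 : 0 < Num.min rho r by rewrite lt_min rho0.
have r1_r : Num.min rho r <= r by rewrite ge_min lexx orbT.
have fE := expands_le fE0 r1_0 r1_r.
set r1 := Num.min rho r in r1_0 r1_r fE.
have B0 := expands_bound_ge0 fE.
have [w0 [U [cc [del [cc0 del0 Ufree wU]]]]] := newton_weights fk d0.
have [P UP] := row_freeP Ufree.
(* [P] recovers [m] from [m *m U]. If two boxes meet, their weights differ by at most 1 in each
   coordinate, so the parameters differ by at most [Lam - 1], less than a grid step. *)
pose Lam := 1 + \sum_i \sum_a `|P i a|.
have Lam0 : 0 < Lam by rewrite ltr_pwDl// sumr_ge0// => i _; exact: sumr_ge0.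
pose K := (r1 * (1 - expR (-1))) ^+ n.
have e1 : 0 < 1 - expR (-1) :> R by rewrite subr_gt0 expR_lt1.
have K0 : 0 < K by rewrite exprn_gt0// mulr_gt0.
pose c1 := (del / (Lam * cc)) ^+ p * K * (B + 1) `^ (- d^-1).
exists c1, 1%N; split.
  by rewrite !mulr_gt0 ?powR_gt0 ?exprn_gt0 ?divr_gt0 ?mulr_gt0// ltr_wpDl.
move=> N N1.
have N0 : 0 < N%:R :> R by rewrite ltr0n.
have N1' : 1 <= N%:R :> R by rewrite ler1n.
have B1 : 0 < B + 1 by rewrite ltr_wpDl.
(* Makes [B * expR (- (tau * cc))] equal to [B / ((B + 1) * N)], at most [1 / N]; [B + 1] is used
   because [B] may be 0. *)
pose tau := ln ((B + 1) * N%:R) / cc.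
have lnBN : ln N%:R <= ln ((B + 1) * N%:R).
  by rewrite ler_ln ?posrE ?mulr_gt0// ler_peMl ?lerDr ?(ltW N0).
have lnN0 : 0 <= ln N%:R :> R by exact: ln_ge0.
have tau0 : 0 <= tau by apply: divr_ge0; [exact: le_trans lnBN|exact: ltW].
have taucc : tau * cc = ln ((B + 1) * N%:R) by rewrite /tau mulfVK// gt_eqF.
(* Counting 0 as a grid point gives at least [del * tau / Lam] points in each direction, while the
   largest still satisfies the bound [del * tau]. *)
pose Q := (Num.truncn (del * tau / Lam)).+1.
have dtL : 0 <= del * tau / Lam.
  by apply: divr_ge0; [exact: mulr_ge0 (ltW del0) tau0|exact: ltW].
pose m (j : {ffun 'I_p -> 'I_Q}) : 'rV[R]_p := \row_a (Lam * (j a)%:R).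
have mle j a : `|m j 0 a| <= del * tau.
  rewrite mxE ger0_norm ?mulr_ge0// ?(ltW Lam0)//.
  rewrite mulrC -ler_pdivlMr//; apply: (@le_trans _ _ (Num.truncn (del * tau / Lam))%:R).
    by rewrite ler_nat -ltnS ltn_ord.
  by have /andP[] := truncn_itv dtL.
pose w j := tau *: w0 + m j *m U.
have wP j := wU tau (m j) tau0 (mle j).
pose l j : 'rV[R]_n := \row_i (r1 * expR (- w j 0 i - 1)).
pose u j : 'rV[R]_n := \row_i (r1 * expR (- w j 0 i)).
have lu j i : l j 0 i <= u j 0 i.
  by rewrite !mxE; apply: ler_wpM2l; rewrite ?(ltW r1_0)// ler_expR gerBl.
have boxE j x i : obox (l j) (u j) x -> r1 * expR (- w j 0 i - 1) < x 0 i < r1 * expR (- w j 0 i).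
  by move=> /(_ i); rewrite !mxE.
have box0 j x i : obox (l j) (u j) x -> 0 < x 0 i < r1 * expR (- w j 0 i).
  move=> /boxE -/(_ i)/andP[xl ->]; rewrite andbT; apply: lt_trans xl.
  by rewrite mulr_gt0// expR_gt0.
exists {ffun 'I_p -> 'I_Q}, l, u; split => //.
- move=> j j' jj'; rewrite -subset0 => x [xj xj'].
  have [a ja] : exists a, j a != j' a.
    apply/existsP; rewrite -negb_forall; apply: contra jj' => /forallP H.
    by apply/eqP/ffunP => a; exact/eqP.
  have wd i : `|(w j - w j') 0 i| <= 1.
    have half j1 j2 : obox (l j1) (u j1) x -> obox (l j2) (u j2) x ->
        w j2 0 i < w j1 0 i + 1.
      move=> /boxE -/(_ i)/andP[h1 _] /boxE -/(_ i)/andP[_ h2].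
      have := lt_trans h1 h2; rewrite ltr_pM2l// ltr_expR; lra.
    have H1 := half _ _ xj xj'; have H2 := half _ _ xj' xj.
    by rewrite !mxE in H1 H2 *; rewrite ler_norml; apply/andP; split; lra.
  have : m j - m j' = (w j - w j') *m P.
    by rewrite /w opprD addrACA subrr add0r -mulmxBl -mulmxA UP mulmx1.
  move=> /(congr1 (fun A : 'rV[R]_p => `|A 0 a|)).
  rewrite !mxE -mulrBr normrM (gtr0_norm Lam0).
  have jj1 : 1 <= `|(j a)%:R - (j' a)%:R| :> R.
    move: ja; rewrite neq_ltn => /orP[jlt|jlt].
      rewrite distrC ger0_norm ?subr_ge0 ?ler_nat ?(ltnW jlt)//.
      by rewrite -natrB ?ler1n ?subn_gt0// ltnW.
    rewrite ger0_norm ?subr_ge0 ?ler_nat ?(ltnW jlt)//.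
    by rewrite -natrB ?ler1n ?subn_gt0// ltnW.
  have : `|\sum_i (w j - w j') 0 i * P i a| <= Lam - 1.
    have -> : Lam - 1 = \sum_i \sum_a `|P i a| by rewrite /Lam addrC addKr.
    apply: le_trans (ler_norm_sum _ _ _) _; apply: ler_sum => i _.
    rewrite normrM; apply: (@le_trans _ _ (1 * `|P i a|)); first exact: ler_wpM2r.
    by rewrite mul1r (bigD1 a)//= lerDl sumr_ge0.
  move=> h1 h2; have := ler_wpM2l (ltW Lam0) jj1; rewrite h2 mulr1 => h3.
  by have := le_trans h3 h1; rewrite lerDl ler0N1.
- move=> j x xj; have [wj0 _ wjal] := wP j; split.
    apply: (@lt_le_trans _ _ r1); last by rewrite ge_min lexx.
    apply: norm_lt_coord => // i; have /andP[x0 xi] := box0 _ _ i xj.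
    rewrite gtr0_norm//; apply: lt_le_trans xi _.
    by rewrite ler_piMr ?expR_le1 ?oppr_le0// ltW.
  apply: (@le_trans _ _ (B * expR (- (tau * cc)))).
    apply: (expands_weight_le fE (w := w j)) => // [al cal|i]; last exact: box0.
    by apply: wjal; rewrite (taylor_coef_expands _ fE).
  rewrite taucc expRN lnK ?posrE ?mulr_gt0// invfM mulrA ler_pdivrMr//.
  by rewrite mulVf ?gt_eqF// ler_pdivrMr// mul1r lerDl.
(* The coordinate sum of [w j] is [tau * cc / d] for every [j], since the rows of [U] have
   coordinate sum 0. *)
have vol j : volume (l j) (u j) = K * ((B + 1) * N%:R) `^ (- d^-1).
  have [_ wsum _] := wP j.
  rewrite /volume (eq_bigr (fun i => (r1 * (1 - expR (-1))) * expR (- w j 0 i))); last first.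
    by move=> i _; rewrite !mxE expRD; ring.
  rewrite big_split/= prodr_const card_ord -expR_sum sumrN wsum taucc.
  rewrite /K /powR gt_eqF ?mulr_gt0//; congr (_ * expR _).
  by rewrite mulNr mulrC.
rewrite (eq_bigr (fun=> K * ((B + 1) * N%:R) `^ (- d^-1))); last by move=> j _; exact: vol.
rewrite sumr_const card_ffun !card_ord powRM ?(ltW B1) ?(ltW N0)//.
rewrite -[leRHS]mulr_natl natrX /c1.
have -> : (del / (Lam * cc)) ^+ p * K * (B + 1) `^ (- d^-1) *
    (N%:R `^ (- d^-1) * ln N%:R ^+ p) =
    (del / (Lam * cc) * ln N%:R) ^+ p * (K * ((B + 1) `^ (- d^-1) * N%:R `^ (- d^-1))).
  by rewrite [(_ * ln _) ^+ _]exprMn; ring.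
apply: ler_wpM2r; first by rewrite !mulr_ge0 ?powR_ge0// ltW.
apply: lerXn2r; rewrite ?nnegrE//.
  by rewrite mulr_ge0// divr_ge0 ?mulr_ge0 ?(ltW del0) ?(ltW Lam0) ?(ltW cc0)//.
apply: le_trans (ltW (truncnS_gt (del * tau / Lam))).
rewrite /tau; apply: (@le_trans _ _ (del / (Lam * cc) * ln ((B + 1) * N%:R))).
  by apply: ler_wpM2l => //; rewrite divr_ge0 ?mulr_ge0 ?(ltW del0) ?(ltW Lam0) ?(ltW cc0)//.
by rewrite le_eqVlt; apply/orP; left; apply/eqP; field; rewrite !gt_eqF.
Qed.

End SmallBoxes.

Section LocalBounds.
Context {R : realType} {n : nat}.

Lemma expands_center (f : 'rV[R]_n -> R) a : analytic_at f a ->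
  exists r K : R, [/\ 0 < r, 0 <= K &
    forall x y, `|x - a| < r -> `|y - a| < r ->
      `|f x| <= K /\ `|f x - f y| <= K * `|x - y|].
Proof.
move=> /analytic_at_expands[c [r [B fE]]]; have [r0 _ _] := fE.
have B0 := expands_bound_ge0 fE.
have Br0 : 0 <= 4 * B / r by rewrite divr_ge0 ?mulr_ge0// ltW.
exists (r / 2), (B + 4 * B / r); split; [by rewrite divr_gt0|exact: addr_ge0|].
move=> x y xa ya; split.
  apply: le_trans (expands_bound fE _) _; last by rewrite lerDl.
  by lra.
apply: le_trans (expands_lipschitz fE xa ya) _.
by apply: ler_wpM2r => //; rewrite lerDr.
Qed.

End LocalBounds.

(** * Boxes along a root of high multiplicity *)

Section RootBoxes.
Context {R : realType} {n : nat}.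

(** Over a grid of cells of side [2 * del] the graph of [b] is replaced by its value at the corner
    of the cell. Since [b] is Lipschitz, [x_i - b] is at most [(1 + 2 * L) * del] on a box of
    half-height [del], so [del] of order [N ^ (- 1 / m)] suffices. About [del ^ (- n)] boxes of
    volume [(2 * del) ^ (n + 1)] have total volume of order [del]. *)
Lemma root_small_boxes (h : 'rV[R]_n.+1 -> R) (a : 'rV[R]_n.+1) (i : 'I_n.+1)
    (b : 'rV[R]_n -> R) (xi : 'rV[R]_n.+1 -> R) (m : nat) (Q : set 'rV[R]_n.+1) :
  (0 < m)%N -> analytic_at b (col' i a) -> analytic_at xi a ->
  b (col' i a) = a 0 i -> nbhs a Q ->
  (\forall x \near a, h x = xi x * (x 0 i - b (col' i x)) ^+ m) ->
  small_boxes h Q (m%:R^-1) 0.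
Proof.
move=> m0 /expands_center[rb [L [rb0 L0 bL]]] /expands_center[rx [X [rx0 X0 xiX]]] ba Qa ha.
have : nbhs a (Q `&` [set x | h x = xi x * (x 0 i - b (col' i x)) ^+ m]) by exact: filterI.
move=> /nbhs_normP[r3 /= r30 r3P].
pose r := Num.min rx r3.
have r0 : 0 < r by rewrite lt_min rx0.
have near_r x : `|x - a| < r ->
    [/\ Q x, h x = xi x * (x 0 i - b (col' i x)) ^+ m & `|xi x| <= X].
  rewrite lt_min => /andP[xx x3].
  have [Qx hx] : Q x /\ h x = xi x * (x 0 i - b (col' i x)) ^+ m.
    by apply: r3P; rewrite /ball_/= distrC.
  by split => //; have [] := xiX x x xx xx.
(* The three bounds keep the grid in the domain of [b], keep the boxes near [a] in the horizontal
   directions, and bound by [r / 4] the variation of [b] from the point below [a]. *)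
pose r' := Num.min (rb / 2) (Num.min (r / 4) (r / (4 * (L + 1)))).
have L1 : 0 < L + 1 by rewrite ltr_wpDl.
have r'0 : 0 < r' by rewrite !lt_min !divr_gt0 ?mulr_gt0.
have r'b : r' < rb by apply: (@le_lt_trans _ _ (rb / 2)); [rewrite ge_min lexx|lra].
have r'r : r' <= r / 4 by rewrite !ge_min lexx orbT.
have r'L : L * r' <= r / 4.
  apply: (@le_trans _ _ ((L + 1) * (r / (4 * (L + 1))))); last first.
    by rewrite le_eqVlt; apply/orP; left; apply/eqP; field; rewrite gt_eqF.
  apply: ler_pM => //; [exact: ltW|by rewrite lerDl|].
  by rewrite !ge_min lexx !orbT.
pose X' := X * (1 + 2 * L) ^+ m + 1.
have XL0 : 0 <= X * (1 + 2 * L) ^+ m by rewrite mulr_ge0// exprn_ge0// addr_ge0// mulr_ge0.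
have X'1 : 1 <= X' by rewrite lerDr.
have X'0 : 0 < X' by exact: lt_le_trans X'1.
(* The threshold on [N], together with [1 <= X'], ensures [del <= r' / 2], so at least one cell fits
   in each direction. *)
exists (2 * (r' / 2) ^+ n * X' `^ (- m%:R^-1)), (Num.bound ((r' / 2) ^- m)).+1.
split; first by rewrite !mulr_gt0 ?powR_gt0 ?exprn_gt0 ?divr_gt0.
move=> N NN.
have N0 : 0 < N%:R :> R by rewrite ltr0n; apply: leq_trans NN.
have XN0 : 0 < X' * N%:R by rewrite mulr_gt0.
pose del := (X' * N%:R) `^ (- m%:R^-1).
have del0 : 0 < del by rewrite powR_gt0.
have delm : del ^+ m = (X' * N%:R)^-1.
  rewrite -powR_mulrn ?powR_ge0// -powRrM mulNr mulVf ?pnatr_eq0 -?lt0n//.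
  by rewrite powR_inv1// ltW.
have delr' : del <= r' / 2.
  rewrite -(@ler_pXn2r _ m)// ?nnegrE ?(ltW del0) ?divr_ge0 ?(ltW r'0)//.
  rewrite delm -[leRHS]invrK lef_pV2 ?posrE//; last by rewrite invr_gt0 exprn_gt0// divr_gt0.
  apply: (@le_trans _ _ N%:R); last by rewrite ler_peMl// ltW.
  apply: le_trans (ltW (archi_boundP _)) _.
    by rewrite invr_ge0 exprn_ge0// divr_ge0// ltW.
  by rewrite ler_nat ltnW.
pose T := Num.truncn (r' / (2 * del)).
have rd0 : 0 <= r' / (2 * del) by rewrite divr_ge0 ?mulr_ge0 ?(ltW r'0) ?(ltW del0).
have rd1 : 1 <= r' / (2 * del) by rewrite ler_pdivlMr ?mulr_gt0// mul1r; lra.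
have /andP[Tle Tgt] := truncn_itv rd0; rewrite -/T in Tle Tgt.
have Tdel : 2 * del * T%:R <= r' by rewrite mulrC -ler_pdivlMr ?mulr_gt0.
(* The integer part of a number that is at least 1 is at least half of it. *)
have Tlow : r' / (4 * del) <= T%:R.
  have -> : r' / (4 * del) = (r' / (2 * del)) / 2 by field; rewrite gt_eqF.
  have T1 : 1 <= T%:R :> R.
    rewrite ler1n lt0n; apply: contraTneq Tgt => ->; rewrite -leNgt//.
  rewrite -natr1 in Tgt; move: (r' / (2 * del)) Tgt => w Tgt; lra.
pose cor (q : {ffun 'I_n -> 'I_T}) : 'rV[R]_n := \row_k (a 0 (lift i k) + 2 * del * (q k)%:R).
have subE (v w : 'rV[R]_n) k : (v - w) 0 k = v 0 k - w 0 k by rewrite !mxE.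
pose l q := insert i (b (cor q) - del) (cor q).
pose u q := insert i (b (cor q) + del) (cor q + const_mx (2 * del)).
have ud q j : u q 0 j - l q 0 j = 2 * del.
  case: (unliftP i j) => [k ->|->]; last by rewrite !insert_at; ring.
  by rewrite !insert_lift !mxE; ring.
exists {ffun 'I_n -> 'I_T}, l, u; split.
- by move=> q j; rewrite -subr_ge0 ud mulr_ge0// ltW.
- move=> q q' qq'; rewrite -subset0 => x [xq xq'].
  have [k qk] : exists k, q k != q' k.
    apply/existsP; rewrite -negb_forall; apply: contra qq' => /forallP H.
    by apply/eqP/ffunP => k; exact/eqP.
  have lt_succ q1 q2 : obox (l q1) (u q1) x -> obox (l q2) (u q2) x -> (q1 k <= q2 k)%N.
    move=> /(_ (lift i k))/andP[h1 _] /(_ (lift i k))/andP[_ h2].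
    have := lt_trans h1 h2; rewrite !insert_lift !mxE -addrA ltrD2l.
    rewrite -[X in _ + X]mulr1 -mulrDr ltr_pM2l ?mulr_gt0//.
    by rewrite natr1 ltr_nat ltnS.
  have H1 := lt_succ _ _ xq xq'; have H2 := lt_succ _ _ xq' xq.
  by move: qk => /negP; apply; apply/eqP/val_inj/anti_leq; rewrite H1 H2.
- move=> q x xq.
  have xk k : cor q 0 k < col' i x 0 k < cor q 0 k + 2 * del.
    by have := xq (lift i k); rewrite !insert_lift !mxE.
  have xil : b (cor q) - del < x 0 i < b (cor q) + del.
    by have := xq i; rewrite !insert_at.
  have cork k : 0 <= cor q 0 k - col' i a 0 k <= r' - 2 * del.
    rewrite !mxE addrC addKr; apply/andP; split; first by rewrite !mulr_ge0// ltW.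
    have := ltn_ord (q k); rewrite -(ler_nat R) -natr1 => qT.
    have : 2 * del * (((q k : nat)%:R : R) + 1) <= r'.
      by apply: le_trans Tdel; apply: ler_wpM2l; rewrite ?mulr_ge0// ltW.
    lra.
  have cora : `|cor q - col' i a| <= r'.
    apply: norm_le_coord => [|k]; first exact: ltW.
    rewrite subE; have /andP[h1 h2] := cork k.
    by rewrite ger0_norm//; lra.
  have xa' : `|col' i x - col' i a| <= r'.
    apply: norm_le_coord => [|k]; first exact: ltW.
    rewrite subE.
    have /andP[h1 h2] := cork k; have /andP[h3 h4] := xk k.
    by rewrite ler_norml; apply/andP; split; lra.
  have xcor : `|col' i x - cor q| <= 2 * del.
    apply: norm_le_coord => [|k]; first by rewrite mulr_ge0// ltW.
    rewrite subE; have /andP[h3 h4] := xk k.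
    by rewrite ler_norml; apply/andP; split; lra.
  have aa : `|col' i a - col' i a| < rb by rewrite subrr normr0.
  have [_ bcor] := bL _ _ (le_lt_trans cora r'b) aa.
  have [_ bx] := bL _ _ (le_lt_trans xa' r'b) (le_lt_trans cora r'b).
  have xa : `|x - a| < r.
    apply: norm_lt_coord => // j; case: (unliftP i j) => [k ->|->].
      have := coord_le_norm (col' i x - col' i a) k; rewrite !mxE => h1.
      by apply: le_lt_trans (le_trans h1 xa') _; lra.
    rewrite !mxE.
    have := le_trans bcor (ler_wpM2l L0 cora); rewrite ba ler_norml => /andP[h1 h2].
    have /andP[h3 h4] := xil.
    by rewrite ltr_norml; apply/andP; split; lra.
  have [Qx -> xix] := near_r _ xa; split => //.
  rewrite normrM normrX.
  have xb : `|x 0 i - b (col' i x)| <= (1 + 2 * L) * del.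
    have := le_trans bx (ler_wpM2l L0 xcor); rewrite ler_norml => /andP[h1 h2].
    have /andP[h3 h4] := xil.
    by rewrite ler_norml; apply/andP; split; lra.
  apply: (@le_trans _ _ (X * ((1 + 2 * L) * del) ^+ m)).
    apply: ler_pM => //.
    by apply: lerXn2r => //; rewrite nnegrE; exact: le_trans xb.
  rewrite exprMn delm mulrA invfM mulrA -[leRHS]mul1r.
  apply: ler_wpM2r; first by rewrite invr_ge0 ltW.
  by rewrite ler_pdivrMr// mul1r lerDl.
rewrite (eq_bigr (fun=> (2 * del) ^+ n.+1)); last first.
  by move=> q _; rewrite /volume (eq_bigr (fun=> 2 * del)) ?prodr_const ?card_ord.
rewrite sumr_const card_ffun !card_ord expr0 mulr1 -[leRHS]mulr_natl natrX.
have -> : 2 * (r' / 2) ^+ n * X' `^ (- m%:R^-1) * N%:R `^ (- m%:R^-1) =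
    (r' / (4 * del)) ^+ n * (2 * del) ^+ n.+1.
  rewrite -mulrA -powRM ?(ltW X'0) ?(ltW N0)// -/del exprS mulrCA -exprMn.
  rewrite (_ : r' / (4 * del) * (2 * del) = r' / 2); last by field; rewrite gt_eqF.
  by ring.
apply: ler_wpM2r; first by rewrite exprn_ge0// mulr_ge0// ltW.
by apply: lerXn2r; rewrite ?nnegrE// divr_ge0 ?mulr_ge0 ?(ltW r'0) ?(ltW del0).
Qed.

End RootBoxes.

(** The theorem types [b] on [n.-1] variables; in dimension 0 there is no index [i]. *)
Lemma root_small_boxes_pred (R : realType) n (h : 'rV[R]_n -> R) (a : 'rV[R]_n) (i : 'I_n)
    (b : 'rV[R]_n.-1 -> R) (xi : 'rV[R]_n -> R) (m : nat) (Q : set 'rV[R]_n) :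
  (0 < m)%N -> analytic_at b (col' i a) -> analytic_at xi a ->
  b (col' i a) = a 0 i -> nbhs a Q ->
  (\forall x \near a, h x = xi x * (x 0 i - b (col' i x)) ^+ m) ->
  small_boxes h Q (m%:R^-1) 0.
Proof. by case: n h a i b xi Q => [? ? []//|n] h a i b xi Q; exact: root_small_boxes. Qed.

(** * Smooth bumps *)

Section FlatFunction.
Context {R : realType}.
Implicit Types (P : {poly R}).

Definition flat P (t : R) : R := if 0 < t then P.[t^-1] * expR (- t^-1) else 0.

(** Each term of the exponential series bounds a power: [u ^ i <= i! * e ^ u]. *)
Lemma horner_le_expR P : exists2 C : R, 0 <= C & forall u, 0 <= u -> `|P.[u]| <= C * expR u.
Proof.
exists (\sum_(i < size P) `|P`_i| * i`!%:R); first by apply: sumr_ge0 => i _; rewrite mulr_ge0.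
move=> u u0; rewrite horner_coef; apply: le_trans (ler_norm_sum _ _ _) _.
rewrite mulr_suml; apply: ler_sum => i _; rewrite normrM -mulrA; apply: ler_wpM2l => //.
rewrite normrX (ger0_norm u0); case: (i : nat) => [|k].
  by rewrite expr0 mul1r -expR0 ler_expR.
have := expR_ge1Dxn k u0; rewrite -ler_pdivrMl ?ltr0n ?fact_gt0// mulrC.
by apply: le_trans; rewrite lerDr.
Qed.

Lemma is_derive_flat P (t : R) :
  is_derive t (1 : R) (flat P) (flat ('X^2 * (P^`() * -1 + P)) t).
Proof.
have [t0|t0|->] := ltgtP t 0.
- rewrite (_ : flat _ t = 0); last by rewrite /flat ltNge (ltW t0).
  apply: (@near_eq_is_derive _ _ _ (cst (0 : R))).
  have : \forall s \near t, s < 0 by exact: lt_nbhsl.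
  by apply: filterS => s s0; rewrite /flat ltNge (ltW s0).
- rewrite (_ : flat _ t = ('X^2 * (P^`() * -1 + P)).[t^-1] * expR (- t^-1)); last by rewrite /flat t0.
  apply: (@near_eq_is_derive _ _ _ (fun s : R => P.[s^-1] * expR (- s^-1))).
    have : \forall s \near t, 0 < s by exact: lt_nbhsr.
    by apply: filterS => s s0; rewrite /flat s0.
  have t_neq0 : t != 0 by rewrite gt_eqF.
  have dinv : is_derive t (1 : R) (fun s : R => s^-1) (- t ^- 2 *: 1).
    exact: is_deriveV.
  have dP : is_derive t (1 : R) (fun s : R => P.[s^-1]) (P^`().[t^-1] * (- t ^- 2 *: 1)).
    exact: (@is_derive1_comp _ (horner P) (fun s : R => s^-1)).
  have dN : is_derive t (1 : R) (fun s : R => - s^-1) (- (- t ^- 2 *: 1)) by exact: is_deriveN.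
  have dE : is_derive t (1 : R) (fun s : R => expR (- s^-1)) (expR (- t^-1) * - (- t ^- 2 *: 1)).
    exact: (@is_derive1_comp _ expR (fun s : R => - s^-1)).
  apply: is_derive_eq (is_deriveM dP dE) _.
  rewrite !hornerE /GRing.scale/= -exprVn; ring.
rewrite (_ : flat _ 0 = 0); last by rewrite /flat ltxx.
suff lim0 : (fun h : R => h^-1 *: ((flat P \o shift 0) (h *: (1 : R)) - flat P 0)) @ (0 : R)^' --> (0 : R).
  by apply: DeriveDef; [apply/cvg_ex; exists 0|rewrite /derive (cvg_lim _ lim0)].
(* The factor ['X^2] turns the difference quotient at 0 into [h] times a bounded quantity. *)
have [C C0 CP] := horner_le_expR ('X^2 * P).
apply/cvgrPdist_le => eps eps0.
near=> h; rewrite sub0r normrN /= addr0 [h *: 1]mulr1 {2}/flat ltxx subr0.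
have [h0|h0] := ltP 0 h; last first.
  by rewrite /flat ltNge h0/= scaler0 normr0 ltW.
rewrite /flat h0.
suff : `|h^-1 * (P.[h^-1] * expR (- h^-1))| <= eps by [].
rewrite !normrM (gtr0_norm (expR_gt0 _)).
have u0 : 0 < h^-1 by rewrite invr_gt0.
rewrite (gtr0_norm u0).
have heps : `|h| <= eps / (C + 1).
  by near: h; apply: dnbhs0_le; rewrite divr_gt0// ltr_wpDl.
rewrite (gtr0_norm h0) in heps.
have HC : h^-1 ^+ 2 * `|P.[h^-1]| <= C * expR h^-1.
  by have := CP _ (ltW u0); rewrite hornerM hornerXn normrM normrX (gtr0_norm u0).
have -> : h^-1 * (`|P.[h^-1]| * expR (- h^-1)) =
    h * (h^-1 ^+ 2 * `|P.[h^-1]| * expR (- h^-1)).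
  by field; rewrite gt_eqF.
apply: (@le_trans _ _ (h * C)).
  apply: ler_wpM2l; first exact: ltW.
  by rewrite expRN ler_pdivrMr ?expR_gt0.
apply: (@le_trans _ _ (h * (C + 1))); first by apply: ler_wpM2l; rewrite ?(ltW h0)// lerDl.
by rewrite -ler_pdivlMr// ltr_wpDl.
Unshelve. all: by end_near. Qed.

End FlatFunction.

Section SmoothBump.
Context {R : realType} {n : nat}.
Implicit Types (f g : 'rV[R]_n -> R) (P : {poly R}).

(** Differentiability to a finite order, by recursion on the order. A product is handled by
    induction on [k] over all pairs of functions, whereas [smooth_on] speaks of iterated derivatives
    of one fixed function. *)
Fixpoint diffk k f : Prop :=
  continuous f /\
  if k is k'.+1 then forall i, (forall x, derivable f x (delta_mx 0 i)) /\ diffk k' (pderiv i f)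
  else True.

Lemma diffkW k f : diffk k.+1 f -> diffk k f.
Proof.
elim: k f => [|k ih] f [cf df]; split=> // i.
by have [dfi dk] := df i; split => //; exact: ih.
Qed.

Lemma diffkD k f g : diffk k f -> diffk k g -> diffk k (f + g).
Proof.
elim: k f g => [|k ih] f g [cf df] [cg dg]; split=> //.
- by move=> x; apply: continuousD; [exact: cf|exact: cg].
- by move=> x; apply: continuousD; [exact: cf|exact: cg].
move=> i; have [dfi dfk] := df i; have [dgi dgk] := dg i.
split=> [x|]; first exact: derivableD.
rewrite (_ : pderiv i (f + g) = pderiv i f + pderiv i g); first exact: ih.
by apply/funext => x; rewrite /pderiv deriveD.
Qed.

Lemma diffkM k f g : diffk k f -> diffk k g -> diffk k (f * g).
Proof.
elim: k f g => [|k ih] f g fk gk.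
  have [cf _] := fk; have [cg _] := gk; split=> //.
  by move=> x; apply: continuousM; [exact: cf|exact: cg].
have fk1 := diffkW fk; have gk1 := diffkW gk.
have [cf df] := fk; have [cg dg] := gk; split=> [x|i].
  by apply: continuousM; [exact: cf|exact: cg].
have [dfi dfk] := df i; have [dgi dgk] := dg i.
split=> [x|]; first exact: derivableM.
rewrite (_ : pderiv i (f * g) = f * pderiv i g + g * pderiv i f).
  by apply: diffkD; exact: ih.
by apply/funext => x; rewrite /pderiv deriveM.
Qed.

Lemma diffk_smooth_on f : (forall k, diffk k f) -> smooth_on setT f.
Proof.
move=> fk s.
have sk k : diffk k (foldr (@pderiv _ n) f s).
  elim: s k => [|i s ih] k /=; first exact: fk.
  by have [_ /(_ i) []] := ih k.+1.
move=> x _; have [cf df] := sk 1%N; split; first exact: cf.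
by move=> i; have [dfi _] := df i.
Qed.

Lemma diffk1 k : diffk k (1 : 'rV[R]_n -> R).
Proof.
have cst_diffk j (a : R) : diffk j (cst a : 'rV[R]_n -> R).
  elim: j a => [|j ih] a; split=> //; try by move=> x; exact: cst_continuous.
  move=> i; split=> [x|]; first exact: derivable_cst.
  rewrite (_ : pderiv i _ = cst 0); first exact: ih.
  by apply/funext => x; rewrite /pderiv derive_cst.
exact: cst_diffk.
Qed.

(** [k0] and [P] are generalised because a derivative along [j] multiplies [k0] by [s] and changes
    [P]; along any other direction it sets [k0] to 0. *)
Lemma diffk_coord (j : 'I_n) k (k0 s c : R) P :
  diffk k (fun x => k0 * flat P (s * x 0 j + c)).
Proof.
have dG (k1 : R) P1 (t : R) : is_derive t (1 : R) (fun t => k1 * flat P1 (s * t + c))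
    (k1 * s * flat ('X^2 * (P1^`() * -1 + P1)) (s * t + c)).
  have d1 : is_derive t (1 : R) (fun t : R => s * t + c) s.
    apply: is_derive_eq (is_deriveD (is_deriveZ s (is_derive_id t (1 : R))) (is_derive_cst c t (1:R))) _.
    by rewrite addr0 [_ *: _]mulr1.
  have d2 := @is_derive1_comp _ (flat P1) (fun t : R => s * t + c) t _ _
    (is_derive_flat P1 (s * t + c)) d1.
  apply: is_derive_eq (is_deriveZ k1 d2) _.
  by rewrite [_ *: _]mulrCA -mulrA mulrC mulrA.
have cG (k1 : R) P1 : continuous (fun x : 'rV[R]_n => k1 * flat P1 (s * x 0 j + c)).
  move=> x; apply: (@continuous_comp _ _ _ (fun x : 'rV[R]_n => x 0 j)
    (fun t => k1 * flat P1 (s * t + c))); first exact: coord_continuous.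
  apply: differentiable_continuous; apply/derivable1_diffP.
  by have [] := dG k1 P1 (x 0 j).
elim: k k0 P => [|k ih] k0 P; split => // i.
have quot (x : 'rV[R]_n) : (fun h => h^-1 *: (((fun x => k0 * flat P (s * x 0 j + c)) \o shift x)
    (h *: delta_mx 0 i) - k0 * flat P (s * x 0 j + c))) @ (0 : R)^' -->
    (if i == j then k0 * s else 0) * flat ('X^2 * (P^`() * -1 + P)) (s * x 0 j + c).
  have [ij|ij] := eqVneq i j.
    subst i; have [H1 H2] := dG k0 P (x 0 j); rewrite -H2.
    apply: cvg_trans H1; apply: near_eq_cvg; apply: nearW => h /=.
    by rewrite !mxE !eqxx.
  rewrite mul0r; apply: cvg_near_cst; apply: nearW => h /=.
  by rewrite !mxE eq_sym (negbTE ij) andbF mulr0 add0r subrr scaler0.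
split=> [x|]; first by apply/cvg_ex; eexists; exact: quot.
rewrite (_ : pderiv i _ = (fun x => (if i == j then k0 * s else 0) *
    flat ('X^2 * (P^`() * -1 + P)) (s * x 0 j + c))); first exact: ih.
by apply/funext => x; rewrite /pderiv /derive (cvg_lim _ (quot x)).
Qed.

(** For each coordinate, the product of [flat 1] at [r + (x_j - p_j)] and at [r - (x_j - p_j)] is
    positive exactly when [|x_j - p_j| < r]. *)
Lemma smooth_bump (p : 'rV[R]_n) (r : R) : 0 < r ->
  exists phi : 'rV[R]_n -> R, [/\ smooth_on setT phi, forall x, 0 <= phi x <= 1,
    0 < phi p & forall x, phi x != 0 -> `|x - p| < r].
Proof.
move=> r0.
pose F j : 'rV[R]_n -> R := (fun x : 'rV[R]_n => 1 * flat 1 (1 * x 0 j + (r - p 0 j))) *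
  (fun x : 'rV[R]_n => 1 * flat 1 (-1 * x 0 j + (r + p 0 j))).
pose phi : 'rV[R]_n -> R := \prod_j F j.
have phiE x : phi x = \prod_j (flat 1 (x 0 j - p 0 j + r) * flat 1 (r - (x 0 j - p 0 j))).
  rewrite /phi fct_prodE; apply: eq_bigr => j _.
  rewrite -[LHS]/((1 * flat 1 (1 * x 0 j + (r - p 0 j))) *
    (1 * flat 1 (-1 * x 0 j + (r + p 0 j)))).
  by rewrite !mul1r mulN1r; congr (flat _ _ * flat _ _); ring.
have flat_ge0 (t : R) : 0 <= flat 1 t <= 1.
  rewrite /flat; case: ifP => t0; last by rewrite lexx ler01.
  by rewrite hornerE mul1r expR_ge0/= expR_le1 oppr_le0 invr_ge0 ltW.
exists phi; split.
- apply: diffk_smooth_on => k; rewrite /phi.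
  apply: (big_ind (diffk k)); [exact: diffk1|exact: diffkM|].
  by move=> j _; apply: diffkM; exact: diffk_coord.
- move=> x; rewrite phiE; apply/andP; split.
    by apply: prodr_ge0 => j _; apply: mulr_ge0; have /andP[] := flat_ge0 (x 0 j - p 0 j + r); have /andP[] := flat_ge0 (r - (x 0 j - p 0 j)).
  apply: (@le_trans _ _ (\prod_(j < n) (1 : R))); last by rewrite big1.
  apply: ler_prod => j _.
  have /andP[h1 h2] := flat_ge0 (x 0 j - p 0 j + r).
  have /andP[h3 h4] := flat_ge0 (r - (x 0 j - p 0 j)).
  by rewrite mulr_ge0//= mulr_ile1.
- rewrite phiE; apply: prodr_gt0 => j _.
  rewrite subrr add0r subr0 /flat r0 (hornerC 1 r^-1) mul1r.
  by rewrite mulr_gt0 ?expR_gt0.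
move=> x; rewrite phiE => /prodf_neq0 H; apply: norm_lt_coord => // j.
have := H j isT; rewrite mulf_eq0 negb_or /flat => /andP[].
case: ifP => [h1 _|]; last by rewrite eqxx.
case: ifP => [h2 _|]; last by rewrite eqxx.
by rewrite !mxE ltr_norml; apply/andP; split; lra.
Qed.

End SmoothBump.

(** * The theorem *)

Section GraphPiece.
Context {R : realType} {n : nat} {S : set 'rV[R]_n.+1}
  {sigma : {measure set (borel_rV R n.+1) -> \bar R}}
  {V : set 'rV[R]_n} {g : 'rV[R]_n -> R} {z : 'rV[R]_n}.
Hypotheses (hsigma : surface_measure S sigma) (oV : open V) (sg : smooth_on V g)
  (gS : graph ord_max V g `<=` S) (Vz : V z).

Definition lift_graph (x : 'rV[R]_n) : 'rV[R]_n.+1 := insert ord_max (g (x + z)) (x + z).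

Definition graph_piece (r : R) : set (borel_rV R n.+1) :=
  cylinder (obox (z - const_mx r) (z + const_mx r)) `&` graph ord_max V g.

Lemma oboxP (r : R) x : 0 < r ->
  obox (z - const_mx r) (z + const_mx r) x <-> `|x - z| < r.
Proof.
move=> r0; split=> [xr|xr i].
  apply: norm_lt_coord => // i; have := xr i; rewrite !mxE => /andP[h1 h2].
  by rewrite ltr_norml; apply/andP; split; lra.
have := le_lt_trans (coord_le_norm (x - z) i) xr; rewrite !mxE ltr_norml => /andP[h1 h2].
by apply/andP; split; lra.
Qed.

Lemma graph_piece_measurable r : measurable (graph_piece r).
Proof.
apply: measurableI; first by apply: open_measurable_rV; exact/cylinder_open/obox_open.
by apply: graph_measurable => // x Vx; have [] := sg [::] Vx.
Qed.

(** Continuity of the first derivatives bounds the surface density near [z]. The resulting piece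
    serves as the finite-measure domain of integration. *)
Lemma graph_piece_finite : exists r : R, [/\ 0 < r,
  forall x, `|x - z| < r -> V x & (sigma (graph_piece r) < +oo)%E].
Proof.
have Vnear : nbhs z V by exact: open_nbhs_nbhs.
have gnear : \forall x \near z, forall i, `|pderiv i g x| <= `|pderiv i g z| + 1.
  apply: (@filter_forall _ _ _ (nbhs z)) => i.
  have ci : {for z, continuous (pderiv i g)} by have [] := sg [:: i] Vz.
  have := iffLR (@cvgrPdist_lt _ _ _ (nbhs z) (nbhs_filter z) _ _) ci _ ltr01.
  apply: (@filterS _ (nbhs z)) => x gx.
  rewrite -lerBlDl; apply: le_trans (lerB_dist _ _) _; rewrite distrC; exact: ltW.
have : nbhs z (V `&` [set x | forall i, `|pderiv i g x| <= `|pderiv i g z| + 1]).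
  exact: filterI.
move=> /nbhs_normP[r /= r0 rP].
have rV x : `|x - z| < r -> V x /\ forall i, `|pderiv i g x| <= `|pderiv i g z| + 1.
  by move=> xr; apply: rP; rewrite /ball_/= distrC.
exists r; split=> // [x /rV[]//|].
apply: (sigma_obox_fin hsigma oV sg gS
  (C := Num.sqrt (1 + \sum_i (`|pderiv i g z| + 1) ^+ 2))).
  by move=> i; rewrite !mxE; lra.
move=> x _ /(oboxP _ r0) /rV[_ gx]; apply: ler_wsqrtr; rewrite lerD2l.
apply: ler_sum => i _; rewrite mxE -expr2 -(real_normK (num_real _)).
by apply: lerXn2r; rewrite ?nnegrE// addr_ge0.
Qed.

Lemma lift_graph_continuous x : V (x + z) -> {for x, continuous lift_graph}.
Proof.
move=> Vx.
have h1 : {for x, continuous (fun x : 'rV[R]_n => x + z)}.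
  by apply: continuousD; [exact: cvg_id|exact: cst_continuous].
have h2 : {for x + z, continuous (fun x : 'rV[R]_n => insert ord_max (g x) x)}.
  by apply: insert_continuous; have [] := sg [::] Vx.
exact: continuous_comp h1 h2.
Qed.

Let l1 : 'rV[R]_n.+1 := insert ord_max 1 (- grad g z).

Lemma dot_insert (t t' : R) (u x : 'rV[R]_n) :
  dot (insert ord_max t u) (insert ord_max t' x) = t * t' + dot u x.
Proof.
rewrite /dot (bigD1_ord ord_max)//= !insert_at; congr (_ + _).
by apply: eq_bigr => i _; rewrite !insert_lift.
Qed.

Lemma enorm_normal_ge1 : 1 <= enorm l1.
Proof.
rewrite /enorm -[leLHS]sqrtr1; apply: ler_wsqrtr.
by rewrite /l1 dot_insert mul1r lerDl sumr_ge0// => i _; rewrite -expr2 sqr_ge0.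
Qed.

(** The subtracted constant is the phase shift [c0] that [limsup_sphere_gt0] allows. *)
Lemma dot_normal x : dot l1 (lift_graph x) - (g z - dot (grad g z) z) =
  g (x + z) - g z - dot (grad g z) x.
Proof.
rewrite /l1 /lift_graph dot_insert mul1r -scaleN1r dotZl dotDr.
by rewrite mulN1r; ring.
Qed.

(** The boxes live in coordinates centred at 0. Translated by [z] and lifted to the graph they form
    the set [A], on which the phase of the normal covector is H up to a constant. *)
Lemma surface_limsup_gt0 (r gam B kappa : R) (p : nat) (phi : 'rV[R]_n.+1 -> R) :
  0 < r -> (forall x, `|x - z| < r -> V x) -> (sigma (graph_piece r) < +oo)%E ->
  continuous phi -> (forall s, 0 <= phi s <= B) ->
  (forall s, S s -> ~ graph_piece r s -> phi s = 0) ->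
  0 < gam <= 2^-1 -> 0 < kappa ->
  small_boxes (fun x => g (x + z) - g z - dot (grad g z) x)
    [set x | `|x| < r /\ kappa <= phi (lift_graph x)] gam p ->
  (0 < limsup_sphere (fun lambda =>
    ComplexField.Normc.normc (surface_fourier S sigma phi lambda) /
    (enorm lambda `^ (- gam) * ln (enorm lambda) ^+ p))%R)%E.
Proof.
move=> r0 rV fin cphi phiB phi_out gam12 kappa0 [c [N0 [c0 boxes]]].
have DS : graph_piece r `<=` S by move=> s [_ /gS].
apply: (limsup_sphere_gt0 (graph_piece_measurable r) DS fin cphi phi_out phiB
  (c0 := g z - dot (grad g z) z) (N0 := N0) enorm_normal_ge1 gam12 c0 kappa0).
move=> N /boxes[I [l [u [lu dis luQ vol]]]].
have shift a x : obox (l a + z) (u a + z) x -> obox (l a) (u a) (x - z).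
  by move=> H i; have := H i; rewrite !mxE ltrBrDr ltrBlDr.
have near a x : obox (l a + z) (u a + z) x -> `|x - z| < r.
  by move=> /shift/luQ[[]].
pose A : set (borel_rV R n.+1) :=
  \bigcup_(a in [set: I]) (cylinder (obox (l a + z) (u a + z)) `&` graph ord_max V g).
have mA : measurable A.
  apply: fin_bigcup_measurable => [|a _]; first exact: finite_finset.
  apply: measurableI; first by apply: open_measurable_rV; exact/cylinder_open/obox_open.
  by apply: graph_measurable => // x Vx; have [] := sg [::] Vx.
exists A; split=> //.
- move=> s [a _ [sa sG]]; split=> //; apply/oboxP => //.
  exact: near sa.
- move=> s [a _ [sa [x Vx xs]]]; move: sa; rewrite -xs /cylinder/= col'_insert => xa.
  have [[_ phik] hN] := luQ _ _ (shift _ _ xa).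
  have xE : insert ord_max (g x) x = lift_graph (x - z) by rewrite /lift_graph subrK.
  by rewrite xE dot_normal; split.
apply: (@le_trans _ _ (\sum_a volume (l a + z) (u a + z))%:E).
  rewrite lee_fin; apply: le_trans vol _; apply: ler_sum => a _.
  rewrite /volume le_eqVlt; apply/orP; left; apply/eqP; apply: eq_bigr => i _.
  by rewrite !mxE; ring.
apply: (sigma_boxes_ge hsigma oV sg gS mA) => //.
- by move=> a x /near /rV.
- by move=> a i; rewrite !mxE lerD2r.
- move=> a b ab; rewrite -subset0 => x [/shift xa /shift xb].
  by have := dis a b ab; rewrite -subset0 => /(_ (x - z)); apply.
move=> a x xa; exists a => //; split; first by rewrite /cylinder/= col'_insert.
by exists x => //; apply: rV; exact: near xa.
Qed.

End GraphPiece.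

Section Cutoffs.
Context {R : realType} {n : nat} {U : set 'rV[R]_n} {phi : 'rV[R]_n -> R}.
Hypothesis cphi : cutoff U phi.

Lemma cutoff_continuous : continuous phi.
Proof. by move=> s; have [sphi _ _] := cphi; have [] := sphi [::] s I. Qed.

Lemma cutoff_supp s : phi s != 0 -> U s.
Proof. by move=> ps; have [_ _ phiU] := cphi; apply: phiU; exact: subset_closure. Qed.

Lemma cutoff_bounded : exists B, forall s, `|phi s| <= B.
Proof.
have [_ supp _] := cphi.
have := continuous_compact (continuous_subspaceT cutoff_continuous) supp.
move=> /compact_bounded[M [_ HM]].
exists (Num.max 0 (M + 1)) => s.
have [->|ps] := eqVneq (phi s) 0; first by rewrite normr0 le_max lexx.
rewrite le_max; apply/orP; right; apply: HM; first by rewrite ltrDl.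
by exists s => //; apply: subset_closure.
Qed.

End Cutoffs.

Theorem theorem1p6 (R : realType) (n : nat) (hn : (2 <= n)%N)
    (S : set 'rV[R]_n.+1) (hS : smooth_hypersurface S)
    (sigma : {measure set (borel_rV R n.+1) -> \bar R})
    (hsigma : surface_measure S sigma)
    (y : 'rV[R]_n.+1) (hy : S y)
    (z : 'rV[R]_n) (g : 'rV[R]_n -> R)
    (V : set 'rV[R]_n) (W : set 'rV[R]_n.+1)
    (hV : open V) (hW : open W) (hz : V z) (hyW : W y)
    (hgraph : S `&` W = graph ord_max V g)
    (hzy : insert ord_max (g z) z = y)
    (hg : forall x, V x -> analytic_at g x)
    (H : 'rV[R]_n -> R)
    (hH : H = fun x => g (x + z) - g z - dot (grad g z) x)
    (hN : newton_polyhedron H !=set0)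
    (k : nat) (hk : critical_face_dim H k) :
  (2 <= newton_distance H ->
   (forall m, face_zero_order H m -> m%:R <= newton_distance H) ->
   exists2 U : set 'rV[R]_n.+1, nbhs y U &
     forall phi, cutoff (W `&` U) phi -> (forall s, 0 <= phi s) -> phi y != 0 ->
       (0 < limsup_sphere (fun lambda =>
          ComplexField.Normc.normc (surface_fourier S sigma phi lambda) /
          (enorm lambda `^ (- (newton_distance H)^-1) *
           ln (enorm lambda) ^+ (n - k - 1)%N))%R)%E)
  /\
  (forall m : nat,
     face_zero_order H m -> (forall m', face_zero_order H m' -> (m' <= m)%N) ->
     Num.max (newton_distance H) 2 < m%:R ->
     (exists a : nat -> 'rV[R]_n,
        [/\ forall l i, a l 0 i != 0, a @ \oo --> (0 : 'rV[R]_n) &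
            forall l, exists (i : 'I_n) (b : 'rV[R]_n.-1 -> R)
                (xi : 'rV[R]_n -> R),
              [/\ analytic_at b (col' i (a l)), analytic_at xi (a l),
                  xi (a l) != 0, b (col' i (a l)) = a l 0 i &
                  \forall x \near a l,
                    H x = xi x * (x 0 i - b (col' i x)) ^+ m]]) ->
     forall U : set 'rV[R]_n.+1, nbhs y U ->
       exists2 phi, cutoff (W `&` U) phi &
         (0 < limsup_sphere (fun lambda =>
            ComplexField.Normc.normc (surface_fourier S sigma phi lambda) /
            (enorm lambda `^ (- m%:R^-1)))%R)%E).
Proof.
have sg : smooth_on V g by exact: analytic_smooth_on.
have gS : graph ord_max V g `<=` S by rewrite -hgraph => s [].
have VSW s : S s -> W s -> graph ord_max V g s by move=> Ss Ws; rewrite -hgraph.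
have [r [r0 rV finr]] := graph_piece_finite hsigma hV sg gS hz.
have lift0 : lift_graph (g := g) (z := z) 0 = y by rewrite /lift_graph add0r.
have [c [rH [BH HE]]] := expands_remainder (grad g z) (hg z hz).
rewrite -hH in HE.
have lift_cont x : V (x + z) -> {for x, continuous (lift_graph (g := g) (z := z))}.
  exact: (lift_graph_continuous sg).
have Vball x : `|x| < r -> V (x + z) by move=> xr; apply: rV; rewrite addrK.
pose piece := cylinder (obox (z - const_mx r) (z + const_mx r)).
have piece_open : open piece by exact/cylinder_open/obox_open.
have pieceE x : piece (lift_graph (g := g) (z := z) x) <-> `|x| < r.
  rewrite /piece /cylinder/= /lift_graph col'_insert.
  by have := @oboxP R n z r (x + z) r0; rewrite addrK.
have out phi s : (forall s, phi s != 0 -> W s /\ piece s) -> S s ->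
    ~ graph_piece (V := V) (g := g) (z := z) r s -> phi s = 0 :> R.
  move=> hphi Ss sN; apply: contrapT => /eqP /hphi[Ws ps]; apply: sN; split => //.
  exact: VSW.
split.
- move=> d2 _; have d0 : 0 < newton_distance H by exact: lt_le_trans d2.
  (* A cutoff supported in [W] and in this cylinder vanishes on [S] outside the piece of finite
     measure. *)
  exists piece.
    by apply: open_nbhs_nbhs; split => //; rewrite -lift0; apply/pieceE; rewrite normr0.
  move=> phi cphi phi0 phiy.
  have [B phiB] := cutoff_bounded cphi.
  have phiy0 : 0 < phi y / 2 by rewrite divr_gt0// lt_neqAle eq_sym phiy phi0.
  have near0 : \forall x \near (0 : 'rV[R]_n), phi y / 2 <= phi (lift_graph (g := g) (z := z) x).
    have c1 : {for (0 : 'rV[R]_n), continuous (phi \o lift_graph (g := g) (z := z))}.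
      apply: continuous_comp; first by apply: lift_cont; rewrite add0r.
      exact: (cutoff_continuous cphi).
    have := iffLR (@cvgrPdist_lt _ _ _ (nbhs (0 : 'rV[R]_n)) (nbhs_filter _) _ _) c1 _ phiy0.
    apply: (@filterS _ (nbhs (0 : 'rV[R]_n))) => x; rewrite /= lift0 => /ltW.
    by rewrite ler_norml => /andP[_]; lra.
  have [rho /= rho0 rhoP] := (iffLR (nbhs_normP _ _)) near0.
  have m0 : 0 < Num.min r rho by rewrite lt_min r0.
  have [c' [N0 [c'0 boxes]]] := newton_small_boxes HE hk d0 m0.
  apply: (surface_limsup_gt0 hsigma hV sg gS r0 rV finr (cutoff_continuous cphi)
    (B := B) (kappa := phi y / 2)) => //.
  + by move=> s; rewrite phi0/=; exact: le_trans (ler_norm _) (phiB s).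
  + move=> s; apply: out => s' /(cutoff_supp cphi)[Ws ps]; by split.
  (* Here [2 <= newton_distance H] gives the exponent at most 1/2. *)
  + by rewrite invr_gt0 d0/= lef_pV2 ?posrE.
  rewrite -hH; exists c', N0; split=> // N /boxes[I [l [u [lu dis luQ vol]]]].
  exists I, l, u; split=> // a x /luQ[/=]; rewrite lt_min => /andP[xr xrho] ->.
  by split=> //; split=> //; apply: rhoP; rewrite /ball_/= sub0r normrN.
move=> m _ _ mmax [a [_ a0 ha]] U yU.
have m3 : 2 < m%:R :> R by apply: le_lt_trans mmax; rewrite le_max lexx orbT.
have m0 : (0 < m)%N by rewrite -(ltr_nat R); lra.
pose W' := W `&` U `&` piece.
(* [U] is only a neighbourhood of [y]; passing to the interior makes [W'] a neighbourhood of the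
   nearby points [lift_graph (a l)] as well. *)
have yW' : nbhs y W'^°.
  apply: nbhs_interior; apply: filterI; last first.
    by apply: open_nbhs_nbhs; split => //; rewrite -lift0; apply/pieceE; rewrite normr0.
  by apply: filterI => //; exact: open_nbhs_nbhs.
have [l [Wl alr]] : exists l, W'^° (lift_graph (g := g) (z := z) (a l)) /\ `|a l| < r.
  have l0 : \forall x \near (0 : 'rV[R]_n), W'^° (lift_graph (g := g) (z := z) x) /\ `|x| < r.
    have h1 : \forall x \near (0 : 'rV[R]_n), `|x| < r by exact: nbhs0_lt.
    have h2 : \forall x \near (0 : 'rV[R]_n), W'^° (lift_graph (g := g) (z := z) x).
      by apply: (lift_cont 0); [rewrite add0r|rewrite lift0].
    exact: filterI h2 h1.
  have [M _ HM] := a0 _ l0; exists M; exact: HM (leqnn M).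
set q := lift_graph (a l) in Wl.
have /nbhs_normP[rho /= rho0 rhoP] : nbhs q W' by exact: Wl.
(* The bump is centred at [q], above the point where the factorisation of H is known. With the
   radius halved, the closed ball containing the closure of its support stays in [W']. *)
have rho20 : 0 < rho / 2 by rewrite divr_gt0.
have [phi [sphi phi01 phiq phi_supp]] := smooth_bump q rho20.
have clos : closure [set s | phi s != 0] `<=` [set s | `|s - q| <= rho / 2].
  have cl : closed [set s : 'rV[R]_n.+1 | `|s - q| <= rho / 2].
    apply: (@closed_comp _ _ (fun s : 'rV[R]_n.+1 => `|s - q|) [set t | t <= rho / 2]).
      move=> s _; apply: (@continuous_comp _ _ _ (fun s : 'rV[R]_n.+1 => s - q)).
        by apply: continuousB; [exact: cvg_id|exact: cst_continuous].
      exact: norm_continuous.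
    exact: closed_le.
  rewrite [X in _ `<=` X](iffLR (closure_id _) cl); apply: closureS => s /phi_supp.
  exact: ltW.
have closW s : closure [set s | phi s != 0] s -> W' s.
  by move=> /clos/= sq; apply: rhoP; rewrite /ball_/= distrC; apply: le_lt_trans sq _; lra.
have cphi : cutoff (W `&` U) phi.
  split=> //; last by move=> s /closW[].
  apply: bounded_closed_compact; last exact: closed_closure.
  exists (`|q| + rho / 2); split; first exact: num_real.
  move=> M /ltW qM s /clos/= sq; apply: le_trans qM.
  rewrite -[s](subrK q) addrC; apply: le_trans (ler_normD _ _) _.
  by rewrite lerD2l.
exists phi => //.
have phiq0 : 0 < phi q / 2 by rewrite divr_gt0.
have [i [b [xi [b_an xi_an _ ba hnear]]]] := ha l.
have Qa : nbhs (a l) [set x | `|x| < r /\ phi q / 2 <= phi (lift_graph (g := g) (z := z) x)].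
  have h1 : \forall x \near a l, `|x| < r.
    have cn : {for a l, continuous (fun x : 'rV[R]_n => `|x|)} by exact: norm_continuous.
    have lr : nbhs `|a l| [set t | t < r] by exact: lt_nbhsl.
    exact: cn lr.
  have h2 : \forall x \near a l, phi q / 2 <= phi (lift_graph (g := g) (z := z) x).
    have c1 : {for a l, continuous (phi \o lift_graph (g := g) (z := z))}.
      apply: continuous_comp; first by apply: lift_cont; exact: Vball.
      exact: (cutoff_continuous cphi).
    have := iffLR (@cvgrPdist_lt _ _ _ (nbhs (a l)) (nbhs_filter _) _ _) c1 _ phiq0.
    apply: (@filterS _ (nbhs (a l))) => x; rewrite /= -/q => /ltW.
    by rewrite ler_norml => /andP[_]; lra.
  exact: filterI h1 h2.
have boxes := root_small_boxes_pred m0 b_an xi_an ba Qa hnear.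
have m2 : 0 < (m%:R^-1 : R) <= 2^-1.
  by rewrite invr_gt0 ltr0n m0/= lef_pV2 ?posrE ?ltr0n// ltW.
have := surface_limsup_gt0 hsigma hV sg gS r0 rV finr (cutoff_continuous cphi)
  (B := 1) (kappa := phi q / 2) (gam := m%:R^-1) (p := 0) phi01.
rewrite -hH => /(_ _ m2 phiq0 boxes) lim.
(* Restores the logarithm to the power 0, to match [p := 0]. *)
rewrite (_ : (fun lambda => _) = (fun lambda =>
  ComplexField.Normc.normc (surface_fourier S sigma phi lambda) /
  (enorm lambda `^ (- m%:R^-1) * ln (enorm lambda) ^+ 0))).
  apply: lim => s; apply: out => s' ps'.
  by have [[]] := closW s' (@subset_closure _ [set s | phi s != 0] s' ps').
by apply/funext => lam; rewrite expr0 mulr1.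
Qed.
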